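(* Let $H$ be a separable real Hilbert space, let $A:\mathrm{dom}(A)\subset H\to H$ be a strictly positive selfadjoint linear operator with spectrum $\sigma(A)\subset(0,\infty)$, and let $f:\sigma(A)\to(0,\infty)$ be a continuous function such that $$\inf_{s\in\sigma(A)} f(s)>0\qquad\text{and}\qquad \sup_{s\in\sigma(A)}\frac{f(s)}{s}<\infty.$$ Let $S(t)=e^{t\mathbb{A}}$, $t\ge 0$, be the $\mathcal{C}_0$-semigroup on $\mathcal{H}=\mathrm{dom}(A^{1/2})\times H$ associated with the abstract damped wave equation $\ddot u+2f(A)\dot u+Au=0$, and let $m_*=\inf_{s\in\sigma(A)}\phi(s)>0$, where $\phi$ is the function defined in the context. Then there exists a constant $C\ge 1$ such that: (I) if $S(t)$ is not resonant, then $\|S(t)\|_{L(\mathcal{H})}\le C e^{-m_* t}$ for all $t\ge 0$; (II) if $S(t)$ is resonant, then $\|S(t)\|_{L(\mathcal{H})}\le C(1+t)e^{-m_* t}$ for all $t\ge 0$.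
   Context: The space $\mathcal{H}=\mathrm{dom}(A^{1/2})\times H$ is endowed with the norm $\|(u,v)\|_{\mathcal{H}}^2=\|A^{1/2}u\|^2+\|v\|^2$, where $\|\cdot\|$ is the norm of $H$; $L(\mathcal{H})$ is the Banach space of bounded linear operators on $\mathcal{H}$ with the operator norm. The operator $f(A)$ is the selfadjoint operator $f(A)=\int_{\sigma(A)}f(s)\,dE_A(s)$, where $E_A$ is the spectral measure of $A$. The operator $\mathbb{A}$ on $\mathcal{H}$ is $\mathbb{A}(u,v)=(v,-Au-2f(A)v)$ with domain $\mathrm{dom}(\mathbb{A})=\{(u,v)\in\mathcal{H}:\ \mathbb{A}(u,v)\in\mathcal{H}\}$, that is, $v\in\mathrm{dom}(A^{1/2})$ and $Au+2f(A)v\in H$, the sum being understood in the dual space of $\mathrm{dom}(A^{1/2})$; equivalently, $v\in\mathrm{dom}(A^{1/2})$ and $A^{1/2}u+2A^{-1/2}f(A)v\in\mathrm{dom}(A^{1/2})$, in which case $Au+2f(A)v$ means $A^{1/2}\big(A^{1/2}u+2A^{-1/2}f(A)v\big)$. It is known that $\mathbb{A}$ generates a $\mathcal{C}_0$-semigroup $S(t)=e^{t\mathbb{A}}$ of linear contractions on $\mathcal{H}$; for $(u_0,v_0)\in\mathcal{H}$, $S(t)(u_0,v_0)=(u(t),\dot u(t))$ is the mild solution of $\ddot u+2f(A)\dot u+Au=0$ with $u(0)=u_0$, $\dot u(0)=v_0$. The continuous function $\phi:\sigma(A)\to(0,\infty)$ is defined by $\phi(s)=f(s)$ if $f(s)\le\sqrt{s}$,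 and $\phi(s)=f(s)-\sqrt{f^2(s)-s}$ if $f(s)>\sqrt{s}$. Set $m_*=\inf_{s\in\sigma(A)}\phi(s)$; the assumptions on $f$ imply $m_*>0$. The semigroup $S(t)$ is said to be resonant if there exists $s_*\in\sigma(A)$ such that $m_*=\phi(s_* )$ and $f(s_* )=\sqrt{s_*}$. *)

(* Defs.v *)
From HB Require Import structures.
From mathcomp Require Import all_boot all_order all_algebra.
From mathcomp Require Import all_classical all_reals all_analysis.
From mathcomp Require Import ring.

Set Implicit Arguments.
Unset Strict Implicit.
Unset Printing Implicit Defensive.

Import Order.TTheory GRing.Theory Num.Theory.
Import numFieldNormedType.Exports.

Local Open Scope classical_set_scope.
Local Open Scope ring_scope.

(** Real Hilbert spaces *)

HB.mixin Record CompleteNormedModule_isHilbert (R : realType) H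
    of CompleteNormedModule R H := {
  inner : {dot H for (@idfun R)} ;
  sqr_norm_inner : forall x : H, `|x| ^+ 2 = inner x x
}.

#[short(type="hilbertType")]
HB.structure Definition Hilbert (R : realType) :=
  {H of CompleteNormedModule_isHilbert R H & CompleteNormedModule R H}.

Definition separable_space (T : topologicalType) :=
  exists D : set T, countable D /\ dense D.

(** Possibly unbounded operators.  [op_app] is total; its values outside
    [op_dom] are junk. *)

Record operator (R : realType) (V : lmodType R) := Operator {
  op_dom : set V ;
  op_app :> V -> V
}.

Section Operators.
Context {R : realType} {V : lmodType R}.
Implicit Types A B : operator V.

Definition op_eq A B :=
  op_dom A = op_dom B /\ forall x, op_dom A x -> A x = B x.

Definition linear_operator A :=
  op_dom A 0 /\
  forall (a : R) x y, op_dom A x -> op_dom A y ->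
    op_dom A (a *: x + y) /\ A (a *: x + y) = a *: A x + A y.

End Operators.

Section HilbertOperators.
Context {R : realType} {H : hilbertType R}.
Implicit Types A : operator H.

(** The last clause is [A^* = A] : its left-hand side says that [y] is in the
    domain of [A^*] and that [A^* y = z]. *)
Definition selfadjoint A :=
  [/\ linear_operator A, dense (op_dom A) &
      forall y z : H,
        (forall x, op_dom A x -> inner (A x) y = inner x z) <->
        (op_dom A y /\ A y = z)].

Definition strictly_positive A :=
  forall x, op_dom A x -> x != 0 -> 0 < inner (A x) x.

Definition resolvent_set A : set R :=
  [set l | exists B : {linear H -> H},
     [/\ continuous B,
         forall y, op_dom A (B y) /\ A (B y) - l *: B y = y &
         forall x, op_dom A x -> B (A x - l *: x) = x]].

(** The real spectrum; for selfadjoint [A] it is also the spectrum of the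
    complexification. *)
Definition spectrum A : set R := ~` resolvent_set A.

End HilbertOperators.

(** Projection-valued measures on the Borel sets of the real line *)

Record spectral_measure (R : realType) (H : hilbertType R) := SpectralMeasure {
  sm_proj :> set (measurableTypeR R) -> {linear H -> H} ;
  sm_idem : forall B, measurable B ->
    forall x, sm_proj B (sm_proj B x) = sm_proj B x ;
  sm_sym : forall B, measurable B ->
    forall x y, inner (sm_proj B x) y = inner x (sm_proj B y) ;
  sm_setT : forall x, sm_proj setT x = x ;
  sm_sigma_additive : forall F : (set (measurableTypeR R))^nat,
    (forall i, measurable (F i)) -> trivIset setT F ->
    forall x, (fun n => \sum_(0 <= i < n) sm_proj (F i) x) @ \oo -->
              sm_proj (\bigcup_i F i) x
}.

(** [scalar_measure E x B = <E(B) x, x>]; the squared norm of the projection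
    [E(B) x] is used so that the value is nonnegative for every set [B]. *)
Definition scalar_measure (R : realType) (H : hilbertType R)
    (E : spectral_measure H) (x : H) (B : set (measurableTypeR R)) : \bar R :=
  (`|E B x| ^+ 2)%:E.

Section ScalarMeasure.
Context {R : realType} {H : hilbertType R}.

Let polarization (x y : H) :
  inner x y = 4^-1 * (`|x + y| ^+ 2 - `|x - y| ^+ 2).
Proof.
have symm : inner y x = inner x y.
  have := @hermitian_subproof _ _ false idfun (@inner R H) y x.
  by rewrite /= expr0 mul1r.
have innerDr (u v w : H) : inner u (v + w) = inner u v + inner u w.
  exact: linearD.
have innerBr (u v w : H) : inner u (v - w) = inner u v - inner u w.
  exact: linearB.
have innerDl (u v w : H) : inner (u + v) w = inner u w + inner v w.
  exact: linearDl.
have innerBl (u v w : H) : inner (u - v) w = inner u w - inner v w.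
  exact: linearBl.
rewrite !sqr_norm_inner innerBl !innerBr innerDl !innerDr symm.
by field.
Qed.

Let cvg_innerl (u : H^nat) (l y : H) :
  u @ \oo --> l -> (fun n => inner (u n) y) @ \oo --> inner l y.
Proof.
move=> ul; rewrite polarization; under eq_fun do rewrite polarization.
apply: cvgMr; apply: cvgB; rewrite expr2; under eq_fun do rewrite expr2.
- by apply: cvgM; apply: cvg_norm; apply: cvgD => //; exact: cvg_cst.
- by apply: cvgM; apply: cvg_norm; apply: cvgB => //; exact: cvg_cst.
Qed.

Variables (E : spectral_measure H) (x : H).

Let sm_set0 : E set0 x = 0.
Proof.
have hc := @sm_sigma_additive _ _ E (fun=> set0) (fun=> measurable0)
  (@trivIset_set0 _ _ _) x.
have h : series (fun=> E set0 x) @ \oo --> E (\bigcup_(i : nat) set0) x := hc.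
have /cvg_series_cvg_0 : cvgn (series (fun=> E set0 x : H)).
  by apply/cvg_ex; eexists; exact: h.
by move/(cvg_unique _ (cvg_cst _)) => ->.
Qed.

Let sm_inner B : measurable B -> `|E B x| ^+ 2 = inner (E B x) x.
Proof. by move=> mB; rewrite sqr_norm_inner -(sm_sym E mB) (sm_idem E mB). Qed.

Let scalar_measure0 : scalar_measure E x set0 = 0%E.
Proof. by rewrite /scalar_measure sm_set0 normr0 expr0n. Qed.

Let scalar_measure_ge0 B : (0 <= scalar_measure E x B)%E.
Proof. by rewrite lee_fin exprn_ge0. Qed.

Let scalar_measure_sigma_additive : semi_sigma_additive (scalar_measure E x).
Proof.
move=> F mF tF mUF; rewrite /scalar_measure.
under eq_fun do rewrite sumEFin.
apply: cvg_EFin; first by near=> n.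
rewrite (sm_inner mUF) (_ : _ \o _ =
  fun n => inner (\sum_(0 <= i < n) E (F i) x) x); last first.
  apply/funext => n /=; rewrite linear_sumlz.
  by apply: eq_bigr => i _; exact: sm_inner.
by apply: cvg_innerl; exact: sm_sigma_additive.
Unshelve. all: by end_near. Qed.

HB.instance Definition _ := isMeasure.Build _ _ _ (scalar_measure E x)
  scalar_measure0 scalar_measure_ge0 scalar_measure_sigma_additive.

End ScalarMeasure.

Section FunctionalCalculus.
Context {R : realType} {H : hilbertType R}.
Variables (E : spectral_measure H) (D : set R) (g : R -> R).

(** [<E(.)x, y>] is the signed measure
    [(scalar_measure E (x + y) - scalar_measure E (x - y)) / 4]. *)
Definition spectral_form (x y : H) : R :=
  4^-1 * ((\int[scalar_measure E (x + y)%R]_(s in D) g s) -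
          (\int[scalar_measure E (x - y)%R]_(s in D) g s)).

Definition spectral_dom : set H :=
  [set x | (\int[scalar_measure E x]_(s in D) ((g s) ^+ 2)%:E < +oo)%E].

(** [\int_D g dE], the operator [T] with domain [spectral_dom] such that
    [<T x, y> = \int_D g(s) d<E(s) x, y>] for all [x], [y] in the domain. *)
Definition spectral_integral : operator H :=
  Operator spectral_dom (fun x =>
    xget 0 [set w | forall y, spectral_dom y ->
                      inner w y = spectral_form x y]).

End FunctionalCalculus.

Definition is_spectral_measure_of (R : realType) (H : hilbertType R)
    (A : operator H) (E : spectral_measure H) :=
  op_eq A (spectral_integral E setT id).

(** Semigroups on a normed space given by a subspace [X] of a vector space [V]
    and a norm [N] on [X] *)

Section Semigroups.
Context {R : realType} {V : lmodType R}.
Variables (X : set V) (N : V -> R).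

Definition bounded_operator (T : V -> V) :=
  [/\ forall x, X x -> X (T x),
      forall (a : R) x y, X x -> X y -> T (a *: x + y) = a *: T x + T y &
      exists M : R, forall x, X x -> N (T x) <= M * N x].

Definition operator_norm (T : V -> V) : R :=
  sup [set N (T x) | x in [set x | X x /\ N x <= 1]].

Definition C0_semigroup (S : R -> V -> V) :=
  [/\ forall t, 0 <= t -> bounded_operator (S t),
      forall x, X x -> S 0 x = x,
      forall s t x, 0 <= s -> 0 <= t -> X x -> S (s + t) x = S s (S t x) &
      forall x, X x -> N (S t x - x) @[t --> 0^'+] --> 0].

Definition is_generator (B : operator V) (S : R -> V -> V) :=
  forall x y,
    [/\ X x, X y & N (t^-1 *: (S t x - x) - y) @[t --> 0^'+] --> 0] <->
    (op_dom B x /\ B x = y).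

End Semigroups.

(** The abstract damped wave equation [u'' + 2 f(A) u' + A u = 0] *)

Section DampedWave.
Context {R : realType} {H : hilbertType R}.
Variables (A : operator H) (E : spectral_measure H) (f : R -> R).

Definition op_fun (g : R -> R) : operator H :=
  spectral_integral E (spectrum A) g.

Definition op_sqrt : operator H := op_fun Num.sqrt.

Definition energy_space : set (H * H) := [set x | op_dom op_sqrt x.1].

Definition energy_norm (x : H * H) : R :=
  Num.sqrt (`|op_sqrt x.1| ^+ 2 + `|x.2| ^+ 2).

(** [A^{-1/2} f(A)] is the function [f(s) / sqrt s] of [A]; it is defined on
    [dom A^{1/2}] when [f(s) / s] is bounded, unlike [f(A)]. *)
Definition wave_arg (x : H * H) : H :=
  op_sqrt x.1 + 2 *: op_fun (fun s => f s / Num.sqrt s) x.2.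

Definition wave_operator : operator (H * H)%type :=
  Operator
    [set x | [/\ op_dom op_sqrt x.1, op_dom op_sqrt x.2 &
                 op_dom op_sqrt (wave_arg x)]]
    (fun x => (x.2, - op_sqrt (wave_arg x))).

Definition phi (s : R) : R :=
  if f s <= Num.sqrt s then f s else f s - Num.sqrt (f s ^+ 2 - s).

Definition m_star : R := inf [set phi s | s in spectrum A].

Definition resonant :=
  exists s, [/\ spectrum A s, m_star = phi s & f s = Num.sqrt s].

End DampedWave.

(* Main.v *)
Require Import Defs.
From HB Require Import structures.
From mathcomp Require Import all_boot all_order all_algebra.
From mathcomp Require Import all_classical all_reals all_analysis.
From mathcomp Require Import measurable_realfun ring lra.
(** In the energy coordinates [(p, v) = (A^{1/2} u, u')] the equation is, at a
    fixed spectral point [s], the oscillator [p' = sg v], [v' = - sg p - 2 f v]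
    with [sg = sqrt s].  For [k = min (f / sg, sg / f)] the quadratic form
    [|p|^2 + |v|^2 + 2 k <p, v>] decays exactly at the rate [2 phi s], and it is
    equivalent to the energy with constants [1 - k] and [1 + k].  Near [k = 1],
    cutting [k] off at [sqrt (1 - q^2)] keeps the rate [2 r] as long as
    [r <= f (1 - q)].  When there is no resonance, compactness gives one [q]
    which is admissible for [r = m_*]; in general [q = 1 / (1 + t)] and
    [r = m_* (1 - q)] are admissible at time [t].

    No functional calculus is applied to these forms: on the range of a spectral
    projection [E(B)] with [B] close to [s] the coefficients may be frozen at
    [s], at the price of an arbitrarily small loss in the rate, and the
    resulting inequalities between [|E(B) .|^2] at times [t] and [0], being
    inequalities between measures, globalize by covering the spectrum with
    countably many small sets. *)

Set Implicit Arguments.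
Unset Strict Implicit.
Unset Printing Implicit Defensive.

Import Order.TTheory GRing.Theory Num.Theory.
Import numFieldNormedType.Exports.

Local Open Scope classical_set_scope.
Local Open Scope ring_scope.

(** * Inner products and spectral measures *)

(** What the choice of [q] costs: if [k^2 <= 1 - q^2], the condition number [(1 + k) / (1 - k)] of
    the form is at most [4 / q^2], so an admissible pair gives the bound [2 / q * exp (- r t)] on
    the operator norm. With [q = 1 / (1 + t)] the prefactor is [2 (1 + t)], the linear growth of a
    double characteristic root, and the reduced rate costs only a factor [exp m_*], because
    [q t <= 1]. Globalization needs [q] and [r] to be common to all spectral points; the radius on
    which the coefficients are frozen may depend on the point, and on an unbounded spectrum it need
    not stay away from 0. The loss in the rate is removed for a fixed time and a fixed datum in the
    domain of the generator, and general data follow by density. The generator yields right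
    derivatives only, so the differential inequality is integrated by a one-sided Gronwall argument.
    The functional calculus mainly serves to show that [A^{1/2}] and [A^{-1/2} f(A)] commute with
    the spectral projections and are almost scalar on small spectral sets. *)

Section InnerProduct.
Context {R : realType} {H : hilbertType R}.
Implicit Types x y z : H.

Lemma innerC x y : inner x y = inner y x.
Proof.
have := @hermitian_subproof _ _ false idfun (@inner R H) x y.
by rewrite /= expr0 mul1r.
Qed.

Lemma innerDr x y z : inner x (y + z) = inner x y + inner x z.
Proof. exact: linearD. Qed.

Lemma innerBr x y z : inner x (y - z) = inner x y - inner x z.
Proof. exact: linearB. Qed.

Lemma innerNr x y : inner x (- y) = - inner x y.
Proof. exact: linearN. Qed.

Lemma innerZr a x y : inner x (a *: y) = a * inner x y.
Proof. exact: linearZ. Qed.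

Lemma innerDl x y z : inner (x + y) z = inner x z + inner y z.
Proof. exact: linearDl. Qed.

Lemma innerBl x y z : inner (x - y) z = inner x z - inner y z.
Proof. exact: linearBl. Qed.

Lemma innerZl a x y : inner (a *: x) y = a * inner x y.
Proof. by rewrite innerC innerZr innerC. Qed.

Lemma inner0l y : inner 0 y = 0.
Proof. exact: linear0l. Qed.

Lemma polarization x y :
  inner x y = 4^-1 * (`|x + y| ^+ 2 - `|x - y| ^+ 2).
Proof.
rewrite !sqr_norm_inner innerBl !innerBr innerDl !innerDr (innerC y x).
by field.
Qed.

Lemma sqr_normD x y : `|x + y| ^+ 2 = `|x| ^+ 2 + 2 * inner x y + `|y| ^+ 2.
Proof. by rewrite !sqr_norm_inner innerDl !innerDr (innerC y x); ring. Qed.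

Lemma inner_sqr_le x y : inner x y ^+ 2 <= `|x| ^+ 2 * `|y| ^+ 2.
Proof.
rewrite -subr_ge0; have [->|y0] := eqVneq y 0.
  by rewrite innerC inner0l normr0 !expr0n/= mulr0 subrr.
have y2 : 0 < `|y| ^+ 2 by rewrite exprn_gt0// normr_gt0.
rewrite -(pmulr_rge0 _ y2).
have := sqr_ge0 `| (`|y| ^+ 2 *: x + (- inner x y) *: y)|.
rewrite sqr_normD innerZl innerZr !sqr_norm_inner !innerZl !innerZr.
by rewrite -!sqr_norm_inner; lra.
Qed.

Lemma inner_le x y : `|inner x y| <= `|x| * `|y|.
Proof.
rewrite -(@ler_pXn2r _ 2)// ?nnegrE ?mulr_ge0//.
by rewrite exprMn -normrX ger0_norm ?sqr_ge0// inner_sqr_le.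
Qed.

Lemma cvg_inner {T : Type} {F : set_system T} {FF : Filter F} (a b : T -> H)
  x y : a @ F --> x -> b @ F --> y -> (fun t => inner (a t) (b t)) @ F --> inner x y.
Proof.
move=> ax by_; rewrite polarization; under eq_fun do rewrite polarization.
apply: cvgMr; apply: cvgB; rewrite expr2; under eq_fun do rewrite expr2.
- by apply: cvgM; apply: cvg_norm; apply: cvgD.
- by apply: cvgM; apply: cvg_norm; apply: cvgB.
Qed.

End InnerProduct.

Section SpectralMeasure.
Context {R : realType} {H : hilbertType R} (E : spectral_measure H).
Implicit Types (x y : H) (B C : set (measurableTypeR R)).
Local Notation mu := (scalar_measure E).

Lemma scalar_measureE x B : mu x B = (`|E B x| ^+ 2)%:E.
Proof. by []. Qed.

Lemma sm_inner x y B : measurable B -> inner (E B x) y = inner (E B x) (E B y).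
Proof. by move=> mB; rewrite -(sm_sym E mB) (sm_idem E mB). Qed.

Lemma sm_norm_inner x B : measurable B -> `|E B x| ^+ 2 = inner (E B x) x.
Proof. by move=> mB; rewrite sqr_norm_inner -sm_inner. Qed.

Lemma sm0 x : E set0 x = 0.
Proof.
have : mu x set0 = 0%E := measure0 _.
rewrite scalar_measureE => -[] /eqP.
by rewrite sqrf_eq0 normr_eq0 => /eqP.
Qed.

(** Polarization: expanding the last hypothesis at [x + z] leaves mixed terms, which symmetry
    identifies. This turns additivity of the scalar measures into identities between operators. *)
Lemma sm_eq (P Q : {linear H -> H}) : 
  (forall x y, inner (P x) y = inner x (P y)) ->
  (forall x y, inner (Q x) y = inner x (Q y)) ->
  (forall x, inner (P x) x = inner (Q x) x) -> P =1 Q.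
Proof.
move=> Psym Qsym PQ x.
have PQi z : inner (P x) z = inner (Q x) z.
  have := PQ (x + z); rewrite (linearD P) (linearD Q) !innerDl !innerDr !PQ.
  by rewrite (Psym z x) (Qsym z x); have := innerC z (P x); have := innerC z (Q x); lra.
apply/eqP; rewrite -subr_eq0 -normr_eq0 -sqrf_eq0 sqr_norm_inner.
by rewrite innerBl PQi subrr.
Qed.

Lemma le_sm x B : measurable B -> `|E B x| <= `|x|.
Proof.
move=> mB; rewrite -(@ler_pXn2r _ 2)// ?nnegrE//.
have := inner_sqr_le (E B x) x; rewrite -sm_norm_inner//.
have [->|] := eqVneq (E B x) 0; first by rewrite normr0 expr0n/= sqr_ge0.
rewrite -normr_gt0 => h; rewrite [X in X <= _]expr2 ler_pM2l// exprn_gt0//.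
Qed.

Lemma smU x B C : measurable B -> measurable C -> [disjoint B & C] ->
  E (B `|` C) x = E B x + E C x.
Proof.
move=> mB mC BC.
suff PQ : E (B `|` C) =1 (E B \+ E C) by exact: PQ.
have mBC : measurable (B `|` C) by exact: measurableU.
apply: sm_eq => [u v|u v|u].
- exact: sm_sym.
- by rewrite /= innerDl innerDr !(sm_sym E mB) !(sm_sym E mC).
- rewrite /= innerDl -!sm_norm_inner//; apply: EFin_inj.
  rewrite EFinD -!scalar_measureE; apply: measureU => //.
  exact/disj_set2P.
Qed.

(** For [y = E C x], the norm of [E (B]|[C) y] is at most that of [y], while its square is
    [|E B y|^2 + |y|^2]; hence [E B y] vanishes. *)
Lemma sm_disj x B C : measurable B -> measurable C -> [disjoint B & C] ->
  E B (E C x) = 0.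
Proof.
move=> mB mC BC; set y := E C x.
have mBC : measurable (B `|` C) by exact: measurableU.
have : `|E (B `|` C) y| ^+ 2 <= `|y| ^+ 2.
  by rewrite ler_pXn2r ?nnegrE// le_sm.
rewrite sm_norm_inner// smU// innerDl -!sm_norm_inner//.
rewrite /y (sm_idem E mC) -/y => h; apply/eqP.
by rewrite -normr_eq0 -sqrf_eq0 eq_le sqr_ge0 andbT; lra.
Qed.

(** Multiplicativity is not a field of [spectral_measure]; it is recovered by splitting both sets
    along their intersection and using the disjoint case. *)
Lemma smI x B C : measurable B -> measurable C -> E B (E C x) = E (B `&` C) x.
Proof.
move=> mB mC.
have mI : measurable (B `&` C) by exact: measurableI.
have mDC : measurable (C `\` B) by exact: measurableD.
have mDB : measurable (B `\` C) by exact: measurableD.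
have EC : E C x = E (B `&` C) x + E (C `\` B) x.
  rewrite -smU//; first by rewrite (setIC B) setUIDK.
  by apply/disj_set2P; rewrite -subset0 => s [] /=; tauto.
rewrite EC linearD (sm_disj _ mB mDC) ?addr0; last first.
  by apply/disj_set2P; rewrite -subset0 => s [] /=; tauto.
set y := E (B `&` C) x.
rewrite -(setUIDK B C) smU//; last first.
  by apply/disj_set2P; rewrite -subset0 => s [] /=; tauto.
rewrite sm_idem// (sm_disj _ mDB mI) ?addr0//.
by apply/disj_set2P; rewrite -subset0 => s [] /=; tauto.
Qed.

End SpectralMeasure.

(** * Step functions *)

Section RintegralConvergence.
Context {R : realType} (mu : {measure set (measurableTypeR R) -> \bar R}).
Local Notation L1 h := (mu.-integrable setT (EFin \o h)).

Lemma le_Rintegrable (f g : R -> R) : measurable_fun [set: measurableTypeR R] f ->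
  (forall s, `|f s| <= g s) -> L1 g -> L1 f.
Proof.
move=> mf fg ig; apply: le_integrable ig => //; first exact/measurable_EFinP.
by move=> s _ /=; rewrite lee_fin (le_trans (fg s))// ler_norm.
Qed.

Lemma RintegrableD (f g : R -> R) : L1 f -> L1 g -> L1 (fun s => f s + g s).
Proof.
move=> fi gi; have := integrableD measurableT fi gi.
by congr integrable; apply/funext.
Qed.

Lemma RintegrableZl (c : R) (f : R -> R) : L1 f -> L1 (fun s => c * f s).
Proof.
move=> fi; have := integrableZl measurableT c fi.
by congr integrable; apply/funext.
Qed.

Lemma cvg_Rintegral (h_ : nat -> R -> R) (h g : R -> R) :
  (forall n, measurable_fun [set: measurableTypeR R] (h_ n)) -> measurable_fun [set: measurableTypeR R] h ->
  (forall s, h_ ^~ s @ \oo --> h s) ->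
  (forall n s, `|h_ n s| <= g s) -> L1 g ->
  (fun n => \int[mu]_s h_ n s) @ \oo --> \int[mu]_s h s.
Proof.
move=> mh_ mh hh hg ig.
have hh' s : EFin \o h_ ^~ s @ \oo --> (h s)%:E.
  by apply: cvg_EFin; [exact: nearW|exact: hh].
have [] := @dominated_convergence _ (measurableTypeR R) R mu setT measurableT
  (fun n => EFin \o h_ n) (EFin \o h) (EFin \o g).
- by move=> n; exact/measurable_EFinP.
- exact/measurable_EFinP.
- by apply: aeW => s _; exact: hh'.
- by [].
- by apply: aeW => s n _ /=; rewrite lee_fin.
move=> ih _ c.
by apply: fine_cvg; rewrite fineK//; exact: integrable_fin_num.
Qed.

End RintegralConvergence.

Section StepFunctions.
Import HBSimple HBNNSimple.
Context {R : realType}.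

(** Step functions are represented by lists of coefficients and measurable sets, possibly
    overlapping, so that one list defines both a function and an operator and the algebra of lists
    needs no side conditions. *)
Definition mset := {B : set (measurableTypeR R) | measurable B}.

Definition step_fun (l : seq (R * mset)) (s : R) : R :=
  \sum_(p <- l) p.1 * \1_(sval p.2) s.

Lemma step_fun_cat l m s : step_fun (l ++ m) s = step_fun l s + step_fun m s.
Proof. exact: big_cat. Qed.

Definition step_scale (a : R) (l : seq (R * mset)) :=
  [seq (a * p.1, p.2) | p <- l].

Lemma step_fun_scale a l s : step_fun (step_scale a l) s = a * step_fun l s.
Proof.
rewrite /step_fun big_map mulr_sumr; apply: eq_bigr => p _ /=.
by rewrite mulrA.
Qed.

Definition step_mul (l m : seq (R * mset)) :=
  [seq (p.1 * q.1, exist measurable (sval p.2 `&` sval q.2)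
          (measurableI _ _ (svalP p.2) (svalP q.2))) | p <- l, q <- m].

Lemma step_fun_mul l m s : step_fun (step_mul l m) s = step_fun l s * step_fun m s.
Proof.
rewrite /step_fun big_allpairs_dep mulr_suml; apply: eq_bigr => p _ /=.
rewrite mulr_sumr; apply: eq_bigr => q _ /=.
by rewrite indicI /=; ring.
Qed.

Lemma measurable_step_fun l : measurable_fun [set: measurableTypeR R] (step_fun l).
Proof.
apply: measurable_sum => p; apply: measurable_funM => //.
exact/measurable_indicP/svalP.
Qed.

Lemma step_fun_bounded l : exists M, forall s, `|step_fun l s| <= M.
Proof.
exists (\sum_(p <- l) `|p.1|) => s.
apply: le_trans (ler_norm_sum _ _ _) _; apply: ler_sum => p _.
by rewrite normrM ler_piMr// indicE normr_nat lern1 leq_b1.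
Qed.

Lemma step_fun_approx_ge0 (g : R -> R) :
  measurable_fun [set: measurableTypeR R] g -> (forall s, 0 <= g s) ->
  exists l : nat -> seq (R * mset), forall s,
    (forall n, 0 <= step_fun (l n) s <= g s) /\
    (fun n => step_fun (l n) s) @ \oo --> g s.
Proof.
move=> mg g0.
have mG : measurable_fun [set: measurableTypeR R] (EFin \o g) by exact/measurable_EFinP.
pose h := nnsfun_approx measurableT mG.
have hg s : (fun n => h n s) @ \oo --> g s.
  have c : EFin \o h^~ s @ \oo --> (g s)%:E.
    by apply: (@cvg_nnsfun_approx _ _ _ _ measurableT _ mG) => // t _; rewrite lee_fin.
  exact: (fine_cvg c).
pose ms n r : mset := exist measurable (h n @^-1` [set r])
  (measurable_sfunP (h n) (measurable_set1 r)).
(* The simple function is written out as a list over its finitely many values, each paired with its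
   level set. *)
exists (fun n => [seq (r, ms n r) | r <- finmap.enum_fset (fset_set (range (h n)))]) => s.
have hE n : step_fun [seq (r, ms n r) | r <- finmap.enum_fset (fset_set (range (h n)))] s = h n s.
  by rewrite /step_fun big_map (fimfunE (h n)) fsbig_finite.
split=> [n|]; last by rewrite (funext hE).
rewrite hE fun_ge0/= -(cvg_lim (@Rhausdorff R) (hg s)).
apply: nondecreasing_cvgn_le; last by apply/cvg_ex; exists (g s); exact: hg.
move=> i j ij; have /lefP := nd_nnsfun_approx measurableT mG ij; exact.
Qed.

(** The positive and negative parts are approximated separately. At each point one of them is zero,
    and so are its approximants, which gives domination by [|g|] with constant 1. *)
Lemma step_fun_approx (g : R -> R) : measurable_fun [set: measurableTypeR R] g ->
  exists l : nat -> seq (R * mset), forall s,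
    (forall n, `|step_fun (l n) s| <= `|g s|) /\
    (fun n => step_fun (l n) s) @ \oo --> g s.
Proof.
move=> mg.
have [p hp] := step_fun_approx_ge0 (measurable_funrpos mg) (funrpos_ge0 g).
have [m hm] := step_fun_approx_ge0 (measurable_funrneg mg) (funrneg_ge0 g).
exists (fun n => p n ++ step_scale (-1) (m n)) => s; split=> [n|].
- rewrite step_fun_cat step_fun_scale mulN1r.
  have [/(_ n) /andP[p0 pg] _] := hp s; have [/(_ n) /andP[m0 mgs] _] := hm s.
  move: pg mgs; rewrite /funrpos /funrneg /=.
  have [g0|g0] := leP 0 (g s).
  + have -> : Num.max (- g s) 0 = 0 by apply/max_idPr; lra.
    by rewrite (ger0_norm g0) ler_norml => ? ?; apply/andP; split; lra.
  + have -> : Num.max (- g s) 0 = - g s by apply/max_idPl; lra.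
    by rewrite (ltr0_norm g0) ler_norml => ? ?; apply/andP; split; lra.
- under eq_fun do rewrite step_fun_cat step_fun_scale mulN1r.
  have -> : g s = g^\+ s - g^\- s by rewrite -{1}(funrposBneg g).
  apply: cvgB; [exact: (hp s).2|exact: (hm s).2].
Qed.

End StepFunctions.

(** * Step functions of the operator and their isometry *)

Section StepOperators.
Context {R : realType} {H : hilbertType R} (E : spectral_measure H).
Implicit Types (x y : H) (l m : seq (R * @mset R)).
Local Notation mu := (scalar_measure E).

Definition step_op l x : H := \sum_(p <- l) p.1 *: E (sval p.2) x.

Lemma step_op_cat l m x : step_op (l ++ m) x = step_op l x + step_op m x.
Proof. exact: big_cat. Qed.

Lemma step_op_scale a l x : step_op (step_scale a l) x = a *: step_op l x.
Proof.
rewrite /step_op big_map scaler_sumr; apply: eq_bigr => p _ /=.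
by rewrite scalerA.
Qed.

Lemma step_op_linear l : linear (step_op l).
Proof.
move=> a x y; rewrite /step_op scaler_sumr -big_split/=; apply: eq_bigr => p _.
by rewrite linearP scalerDr !scalerA mulrC.
Qed.

HB.instance Definition _ l :=
  GRing.isLinear.Build R H H _ (step_op l) (step_op_linear l).

Lemma step_op_mul l m x : step_op (step_mul l m) x = step_op l (step_op m x).
Proof.
rewrite {1 2}/step_op big_allpairs_dep; apply: eq_bigr => p _ /=.
rewrite /step_op linear_sum scaler_sumr; apply: eq_bigr => q _ /=.
rewrite linearZ scalerA/= smI//; exact: svalP.
Qed.

Lemma sm_step_op B l x : measurable B -> E B (step_op l x) = step_op l (E B x).
Proof.
move=> mB; rewrite /step_op linear_sum; apply: eq_bigr => p _.
have mp := svalP p.2.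
by rewrite linearZ/= !smI// setIC.
Qed.

Lemma step_op_sym l x y : inner (step_op l x) y = inner x (step_op l y).
Proof.
rewrite /step_op [RHS]linear_sumr linear_sumlz; apply: eq_bigr => p _ /=.
by rewrite innerZl innerZr (sm_sym E (svalP p.2)).
Qed.

Lemma measure_setT_lty x : (mu x setT < +oo)%E.
Proof. by rewrite scalar_measureE ltry. Qed.

Lemma integrable_cst x (c : R) : (mu x).-integrable setT (EFin \o cst c).
Proof.
apply: measurable_bounded_integrable => //; first exact: measure_setT_lty.
exists `|c|; split; rewrite ?num_real// => M cM s _ /=; exact: ltW.
Qed.

Lemma integrable_step_fun x l : (mu x).-integrable setT (EFin \o step_fun l).
Proof.
have [M lM] := step_fun_bounded l.
apply: (le_Rintegrable (measurable_step_fun l) lM); exact: integrable_cst.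
Qed.

Lemma inner_step_op l x : inner (step_op l x) x = \int[mu x]_s step_fun l s.
Proof.
elim: l => [|[c B] l IHl].
  rewrite /step_op big_nil inner0l.
  under eq_Rintegral do rewrite /step_fun big_nil.
  by rewrite Rintegral_cst// mul0r.
pose l1 : seq (R * mset) := [:: (c, B)].
rewrite -(cat1s (c, B) l) -/l1 step_op_cat innerDl IHl.
under [RHS]eq_Rintegral do rewrite step_fun_cat.
rewrite RintegralD//; [|exact: integrable_step_fun..]; congr (_ + _).
rewrite /step_op big_seq1/= innerZl.
under [RHS]eq_Rintegral do rewrite /step_fun big_seq1/=.
have mB := svalP B.
rewrite RintegralZl//; last first.
  apply: (le_Rintegrable (g := cst 1)); last exact: integrable_cst.
  - exact/measurable_indicP.
  - by move=> s; rewrite indicE normr_nat lern1 leq_b1.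
by rewrite /Rintegral integral_indic//= setIT -sm_norm_inner.
Qed.

(** Symmetry and multiplicativity give [|g(A) x|^2 = <g^2(A) x, x>]. This isometry is what allows
    the calculus to be extended by completion. *)
Lemma sqr_norm_step_op l x : `|step_op l x| ^+ 2 = \int[mu x]_s step_fun l s ^+ 2.
Proof.
rewrite sqr_norm_inner step_op_sym -step_op_mul innerC inner_step_op.
by apply: eq_Rintegral => s _; rewrite step_fun_mul expr2.
Qed.

End StepOperators.

(** * Functional calculus *)

Section NormConvergence.
Context {R : realType} {V : normedModType R}.

Lemma cvg_sqr_norm (u : nat -> V) (l : V) :
  (fun n => `|u n - l| ^+ 2) @ \oo --> (0 : R) -> u @ \oo --> l.
Proof.
move=> h; apply/cvgrPdist_lt => e e0.
have e20 : 0 < e ^+ 2 by rewrite exprn_gt0.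
have P := cvgr0_norm_lt _ h _ e20; near=> n.
have : `|(`|u n - l| ^+ 2)| < e ^+ 2 by near: n; exact: P.
by rewrite ger0_norm ?sqr_ge0// (@ltr_pXn2r _ 2) ?nnegrE ?(ltW e0)// (distrC l).
Unshelve. all: by end_near. Qed.

Lemma linear_bound_continuous {W : normedModType R} (f : {linear V -> W}) (M : R) :
  (forall x, `|f x| <= M * `|x|) -> continuous f.
Proof.
move=> fM; apply: bounded_linear_continuous.
exists `|M|; split; rewrite ?num_real// => K MK.
near=> x => /=; rewrite (le_trans (fM x))//.
have M0 : 0 < K by rewrite (le_lt_trans _ MK).
rewrite (@le_trans _ _ (K * 1))//; last by rewrite mulr1.
apply: (@le_trans _ _ (K * `|x|)).
  by rewrite ler_wpM2r// (le_trans (ler_norm M))// ltW.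
by rewrite ler_pM2l//; near: x; exact: nbhs0_le.
Unshelve. all: by end_near. Qed.

End NormConvergence.

Section FunctionalCalculus.
Context {R : realType} {H : hilbertType R} (E : spectral_measure H).
Implicit Types (x y : H) (g h : R -> R) (B : set (measurableTypeR R)).
Local Notation mu := (scalar_measure E).
Local Notation borel g := (measurable_fun [set: measurableTypeR R] g).

Definition sqint g x := (mu x).-integrable setT (EFin \o (fun s => g s ^+ 2)).

Definition approximated_by g (l : nat -> seq (R * @mset R)) := forall s,
  (forall n, `|step_fun (l n) s| <= `|g s|) /\
  (fun n => step_fun (l n) s) @ \oo --> g s.

(** One approximating sequence is fixed for each [g], independently of the vector, so that linearity
    in the vector survives the limit. Where no such sequence exists the value is the empty list. *)
Definition step_approx g : nat -> seq (R * @mset R) :=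
  if pselect (exists l, approximated_by g l) is left e then sval (cid e)
  else fun=> [::].

Lemma step_approxP g : borel g -> approximated_by g (step_approx g).
Proof.
move=> /step_fun_approx ex; rewrite /step_approx.
by case: pselect => // e; exact: svalP.
Qed.

Lemma le_sqint g h x : borel g -> (forall s, `|g s| <= `|h s|) ->
  sqint h x -> sqint g x.
Proof.
move=> mg gh; apply: le_Rintegrable; first exact: measurable_funX.
by move=> s; rewrite normrX -[leRHS]real_normK ?num_real// lerXn2r ?nnegrE.
Qed.

Lemma sqintD g h x : borel g -> borel h -> sqint g x -> sqint h x ->
  sqint (fun s => g s + h s) x.
Proof.
move=> mg mh ig ih.
apply: (@le_Rintegrable _ _ _ (fun s => 2 * g s ^+ 2 + 2 * h s ^+ 2)).
- by apply: measurable_funX; exact: measurable_funD.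
- move=> s; rewrite ger0_norm ?sqr_ge0//.
  by have := sqr_ge0 (g s - h s); lra.
- by apply: RintegrableD; exact: RintegrableZl.
Qed.

Lemma sqintZ c g x : sqint g x -> sqint (fun s => c * g s) x.
Proof.
move=> /(RintegrableZl (c ^+ 2)); rewrite /sqint.
by congr integrable; apply/funext => s /=; rewrite exprMn.
Qed.

Lemma sqintN g x : sqint g x -> sqint (fun s => - g s) x.
Proof.
by rewrite /sqint; congr integrable; apply/funext => s /=; rewrite sqrrN.
Qed.

Lemma sqintB g h x : borel g -> borel h -> sqint g x -> sqint h x ->
  sqint (fun s => g s - h s) x.
Proof.
move=> mg mh ig ih; apply: sqintD => //; last exact: sqintN.
exact: measurable_funN.
Qed.

Lemma sqint_step_fun l x : sqint (step_fun l) x.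
Proof.
have [M lM] := step_fun_bounded l.
apply: (@le_sqint _ (cst M)); first exact: measurable_step_fun.
  by move=> s; rewrite (le_trans (lM s))//= ler_norm.
exact: (integrable_cst E x (M ^+ 2)).
Qed.

Lemma cvg_sqr_dist (a : nat -> R -> R) g h (b : R -> R) x :
  (forall n, borel (a n)) -> borel g -> borel h -> borel b ->
  (forall s, a ^~ s @ \oo --> g s) -> (forall n s, `|a n s| <= `|h s|) ->
  sqint h x -> sqint b x ->
  (fun n => \int[mu x]_s (a n s - b s) ^+ 2) @ \oo -->
    \int[mu x]_s (g s - b s) ^+ 2.
Proof.
move=> ma mg mh mb ag ah ih ib.
apply: (@cvg_Rintegral _ _ _ _ (fun s => 2 * h s ^+ 2 + 2 * b s ^+ 2)).
- by move=> n; apply: measurable_funX; exact: measurable_funB.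
- by apply: measurable_funX; exact: measurable_funB.
- move=> s; rewrite expr2; under eq_fun do rewrite expr2.
  by apply: cvgM; apply: cvgB => //; exact: cvg_cst.
- move=> n s; rewrite ger0_norm ?sqr_ge0//.
  have : a n s ^+ 2 <= h s ^+ 2.
    rewrite -(real_normK (num_real (a n s))) -(real_normK (num_real (h s))).
    by rewrite lerXn2r ?nnegrE.
  by have := sqr_ge0 (a n s + b s); lra.
- by apply: RintegrableD; exact: RintegrableZl.
Qed.

Lemma sqr_dist_step_op l m x :
  `|step_op E l x - step_op E m x| ^+ 2 =
  \int[mu x]_s (step_fun l s - step_fun m s) ^+ 2.
Proof.
rewrite -scaleN1r -step_op_scale -step_op_cat sqr_norm_step_op.
by apply: eq_Rintegral => s _; rewrite step_fun_cat step_fun_scale mulN1r.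
Qed.

(* The operator [\int g dE], with junk values outside its domain [sqint g]. *)
Definition fcalc g x : H := lim (step_op E (step_approx g n) x @[n --> \oo]).

Lemma Rintegral_sqr0 x : \int[mu x]_s ((0:R) ^+ 2) = 0.
Proof. by rewrite expr0n/= Rintegral_cst// mul0r. Qed.

Lemma cvg_step_approx_dist g x : borel g -> sqint g x ->
  (fun n => \int[mu x]_s (step_fun (step_approx g n) s - g s) ^+ 2) @ \oo --> (0:R).
Proof.
move=> mg ig; rewrite -(Rintegral_sqr0 x).
have -> : \int[mu x]_s ((0:R) ^+ 2) = \int[mu x]_s ((g s - g s) ^+ 2).
  by apply: eq_Rintegral => s _; rewrite subrr.
apply: (@cvg_sqr_dist _ _ g) => //.
- by move=> n; exact: measurable_step_fun.
- by move=> s; have [] := step_approxP mg s.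
- by move=> n s; have [] := step_approxP mg s.
Qed.

Lemma fcalc_cvg g x : borel g -> sqint g x ->
  step_op E (step_approx g n) x @[n --> \oo] --> fcalc g x.
Proof.
move=> mg ig; apply: cauchy_cvg; apply: cauchy_exP => e e0.
(* Two approximants at squared distance below [e^2 / 4] from [g] are at squared distance below [e^2]
   from each other, by [(a - b)^2 <= 2 a^2 + 2 b^2]. *)
have e40 : 0 < e ^+ 2 / 4 by rewrite divr_gt0// exprn_gt0.
pose d n := `|\int[mu x]_s (step_fun (step_approx g n) s - g s) ^+ 2|.
have [N _ hN] : \forall n \near \oo, d n < e ^+ 2 / 4.
  exact: (cvgr0_norm_lt _ (cvg_step_approx_dist mg ig)).
have msf n : borel (step_fun (step_approx g n)) by exact: measurable_step_fun.
have isf n : sqint (step_fun (step_approx g n)) x by exact: sqint_step_fun.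
have isg n := sqintB (msf n) mg (isf n) ig.
exists (step_op E (step_approx g N) x), N => // m Nm.
rewrite /= -ball_normE /ball_/=; set n := N in Nm *.
have dn : d n < e ^+ 2 / 4 by apply: hN => /=.
have dm : d m < e ^+ 2 / 4 by apply: hN.
rewrite -(@ltr_pXn2r _ 2) ?nnegrE ?(ltW e0)// sqr_dist_step_op.
apply: (@le_lt_trans _ _ (2 * d n + 2 * d m)); last by lra.
apply: (@le_trans _ _ (\int[mu x]_s
   (2 * (step_fun (step_approx g n) s - g s) ^+ 2 +
    2 * (step_fun (step_approx g m) s - g s) ^+ 2))).
  apply: le_Rintegral => //.
  - exact: sqintB.
  - by apply: RintegrableD; [exact: (RintegrableZl _ (isg n))|exact: (RintegrableZl _ (isg m))].
  - move=> s _; have := sqr_ge0 ((step_fun (step_approx g n) s - g s) +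
      (step_fun (step_approx g m) s - g s)); lra.
rewrite RintegralD//;
  [|exact: (RintegrableZl _ (isg n))|exact: (RintegrableZl _ (isg m))].
rewrite !RintegralZl//; [|exact: isg|exact: isg].
by rewrite lerD// ler_pM2l// ler_norm.
Qed.

(** The step isometry with one of its two arguments passed to the limit. Later facts on [fcalc]
    compare it with step operators through this formula. *)
Lemma fcalc_dist l g x : borel g -> sqint g x ->
  `|step_op E l x - fcalc g x| ^+ 2 = \int[mu x]_s (step_fun l s - g s) ^+ 2.
Proof.
move=> mg ig.
have c1 : (fun n => `|step_op E l x - step_op E (step_approx g n) x| ^+ 2) @ \oo
    --> `|step_op E l x - fcalc g x| ^+ 2.
  have c : (fun n => `|step_op E l x - step_op E (step_approx g n) x|) @ \oo
    --> `|step_op E l x - fcalc g x|.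
    by apply: cvg_norm; apply: cvgB; [exact: cvg_cst|exact: fcalc_cvg].
  by rewrite expr2; under eq_fun do rewrite expr2; exact: cvgM.
have c2 : (fun n => \int[mu x]_s (step_fun (step_approx g n) s - step_fun l s) ^+ 2)
    @ \oo --> \int[mu x]_s (g s - step_fun l s) ^+ 2.
  apply: (@cvg_sqr_dist _ _ g) => //.
  - by move=> n; exact: measurable_step_fun.
  - exact: measurable_step_fun.
  - by move=> s; have [] := step_approxP mg s.
  - by move=> n s; have [] := step_approxP mg s.
  - exact: sqint_step_fun.
have -> : \int[mu x]_s (step_fun l s - g s) ^+ 2 = \int[mu x]_s (g s - step_fun l s) ^+ 2.
  by apply: eq_Rintegral => s _; rewrite -sqrrN opprB.
move: c1; under eq_fun => n.
  rewrite sqr_dist_step_op.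
  under eq_Rintegral do rewrite -sqrrN opprB.
  over.
by move=> c1; exact: (cvg_unique _ c1 c2).
Qed.

End FunctionalCalculus.

(** * Domains, localization and products in the functional calculus *)

Section FunctionalCalculusTheory.
Context {R : realType} {H : hilbertType R} (E : spectral_measure H).
Implicit Types (x y : H) (g h : R -> R) (M : R) (B : set (measurableTypeR R)).
Local Notation mu := (scalar_measure E).
Local Notation borel g := (measurable_fun [set: measurableTypeR R] g).

Lemma fcalc_unique (a : nat -> seq (R * mset)) g x : borel g -> sqint E g x ->
  (fun n => \int[mu x]_s (step_fun (a n) s - g s) ^+ 2) @ \oo --> (0:R) ->
  step_op E (a n) x @[n --> \oo] --> fcalc E g x.
Proof.
move=> mg ig c; apply: cvg_sqr_norm.
by under eq_fun do rewrite (fcalc_dist _ mg ig).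
Qed.

Lemma step_op_bounded l : exists M, forall x, `|step_op E l x| <= M * `|x|.
Proof.
have [M lM] := step_fun_bounded l; exists M => x.
have M0 : 0 <= M by rewrite (le_trans _ (lM 0)).
rewrite -(@ler_pXn2r _ 2) ?nnegrE ?mulr_ge0// sqr_norm_step_op exprMn.
rewrite (@le_trans _ _ (\int[mu x]_s (M ^+ 2)))//.
  apply: le_Rintegral => //; first exact: sqint_step_fun.
    exact: (integrable_cst E x (M ^+ 2)).
  move=> s _; rewrite -(real_normK (num_real (step_fun l s))).
  by rewrite lerXn2r ?nnegrE.
by rewrite Rintegral_cst// /= sm_setT.
Qed.

Lemma cvg_step_op {T : Type} {F : set_system T} {FF : Filter F} l (u : T -> H) x :
  u @ F --> x -> step_op E l (u t) @[t --> F] --> step_op E l x.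
Proof.
have [M lM] := step_op_bounded l => ux.
have c : continuous (step_op E l) := linear_bound_continuous lM.
exact: cvg_comp _ _ ux (c x).
Qed.

Lemma cvg_sm {T : Type} {F : set_system T} {FF : Filter F} B (u : T -> H) x :
  measurable B -> u @ F --> x -> E B (u t) @[t --> F] --> E B x.
Proof.
move=> mB ux; have EM y : `|E B y| <= 1 * `|y| by rewrite mul1r le_sm.
have c : continuous (E B) := linear_bound_continuous EM.
exact: cvg_comp _ _ ux (c x).
Qed.

(* By Fatou's lemma the domain is read off the approximants, so that its
   stability properties follow from the linearity of [step_op]. *)
Lemma sqintP g x : borel g ->
  sqint E g x <-> exists M, forall n, `|step_op E (step_approx g n) x| <= M.
Proof.
move=> mg; split=> [ig|[M gM]].
  have [M [_ hM]] := cvg_seq_bounded (cvgP _ (fcalc_cvg mg ig)).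
  by exists (M + 1) => n; apply: hM => //; rewrite ltrDl.
have mg2 : measurable_fun [set: measurableTypeR R] (EFin \o (fun s => g s ^+ 2)).
  by apply/measurable_EFinP; exact: measurable_funX.
apply/integrableP; split => //.
pose u n (s : measurableTypeR R) := (step_fun (step_approx g n) s ^+ 2)%:E.
have ug s : u ^~ s @ \oo --> (g s ^+ 2)%:E.
  apply: cvg_EFin; first exact: nearW.
  have [_ c] := step_approxP mg s.
  by rewrite /comp/= expr2; under eq_fun do rewrite expr2; exact: cvgM.
have -> : (\int[mu x]_s `|(EFin \o (fun s => (g s ^+ 2)%R)) s| =
           \int[mu x]_s limn_einf (u ^~ s))%E.
  apply: eq_integral => s _.
  rewrite (cvg_limn_einf_sup (ug s)).1 /= ger0_norm ?sqr_ge0//.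
apply: le_lt_trans (fatou _ _ _ _) _ => //.
- move=> n; apply/measurable_EFinP; apply: measurable_funX.
  exact: measurable_step_fun.
- by move=> n s _; rewrite lee_fin sqr_ge0.
apply: (@le_lt_trans _ _ (M ^+ 2)%:E); last exact: ltry.
rewrite limn_einf_lim; apply: lime_le; first exact: is_cvg_einfs.
apply: nearW => n; apply: ge_ereal_inf => //.
exists (\int[mu x]_s u n s)%E; first by exists n => /=.
have iu : (mu x).-integrable setT (u n) := sqint_step_fun E (step_approx g n) x.
rewrite -[leLHS]fineK; last exact: integrable_fin_num.
rewrite lee_fin -[leLHS]/(\int[mu x]_s (step_fun (step_approx g n) s ^+ 2)).
rewrite -sqr_norm_step_op lerXn2r ?nnegrE//.
by rewrite (le_trans _ (gM 0%N)).
Qed.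

Lemma sqint_lin g a x y : borel g -> sqint E g x -> sqint E g y ->
  sqint E g (a *: x + y).
Proof.
move=> mg /(sqintP _ mg)[M xM] /(sqintP _ mg)[N yN].
apply/(sqintP _ mg); exists (`|a| * M + N) => n.
rewrite step_op_linear; apply: le_trans (ler_normD _ _) _; apply: lerD => //.
by rewrite normrZ ler_wpM2l.
Qed.

Lemma fcalc_lin g a x y : borel g -> sqint E g x -> sqint E g y ->
  fcalc E g (a *: x + y) = a *: fcalc E g x + fcalc E g y.
Proof.
move=> mg ix iy; apply: cvg_lim => //.
under eq_fun do rewrite step_op_linear.
by apply: cvgD; [apply: cvgZr|]; exact: fcalc_cvg.
Qed.

Lemma sqint0 g : borel g -> sqint E g 0.
Proof.
by move=> mg; apply/(sqintP _ mg); exists 0 => n; rewrite linear0 normr0.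
Qed.

Lemma fcalc_sm g B x : borel g -> measurable B -> sqint E g x ->
  fcalc E g (E B x) = E B (fcalc E g x).
Proof.
move=> mg mB ix; apply: cvg_lim => //.
under eq_fun do rewrite -sm_step_op//.
have c := fcalc_cvg mg ix.
exact: cvg_sm.
Qed.

Lemma ae_sm B x : measurable B -> {ae mu (E B x), forall s, B s}.
Proof.
move=> mB; exists (~` B); split; [exact: measurableC| |by []].
rewrite scalar_measureE smI//; last exact: measurableC.
by rewrite setICl sm0 normr0 expr0n.
Qed.

Lemma integral_sm_le g B x M : borel g -> measurable B ->
  (forall s, B s -> `|g s| <= M) ->
  (\int[mu (E B x)]_s `|(g s ^+ 2)%:E| <= (M ^+ 2 * `|E B x| ^+ 2)%:E)%E.
Proof.
move=> mg mB gM.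
apply: (@le_trans _ _ (\int[mu (E B x)]_s (M ^+ 2)%:E)%E); last first.
  by rewrite integral_cst// /= scalar_measureE sm_setT -EFinM.
apply: ae_ge0_le_integral => //.
- apply: measurableT_comp => //; apply/measurable_EFinP; exact: measurable_funX.
- by move=> s _; rewrite lee_fin sqr_ge0.
- apply: filterS (ae_sm x mB) => s Bs _.
  rewrite /= lee_fin normrX; have := gM _ Bs => gMs.
  by rewrite lerXn2r ?nnegrE// (le_trans _ gMs).
Qed.

Lemma sqint_bounded_on g B x M : borel g -> measurable B ->
  (forall s, B s -> `|g s| <= M) -> sqint E g (E B x).
Proof.
move=> mg mB gM; apply/integrableP; split.
  by apply/measurable_EFinP; exact: measurable_funX.
by rewrite (le_lt_trans (integral_sm_le _ mg mB gM))// ltry.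
Qed.

(** By [fcalc_dist] with the constant step function [c], the squared distance is the integral of
    [(g - c)^2] against a measure carried by [B]. This is the estimate that freezes coefficients. *)
Lemma fcalc_near g B x (c e : R) : borel g -> measurable B -> 0 <= e ->
  (forall s, B s -> `|g s - c| <= e) ->
  `|fcalc E g (E B x) - c *: E B x| <= e * `|E B x|.
Proof.
move=> mg mB e0 ge.
have ig : sqint E g (E B x).
  apply: (@sqint_bounded_on g B x (e + `|c|)) => // s /ge gs.
  by rewrite -(subrK c (g s)) (le_trans (ler_normD _ _))// lerD.
pose T : @mset R := exist measurable [set: measurableTypeR R] measurableT.
pose l : seq (R * mset) := [:: (c, T)].
have <- : step_op E l (E B x) = c *: E B x by rewrite /step_op big_seq1/= sm_setT.
have lE s : step_fun l s = c by rewrite /step_fun big_seq1/= indicE in_setT mulr1.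
rewrite -(@ler_pXn2r _ 2) ?nnegrE ?mulr_ge0// distrC fcalc_dist// exprMn.
have mgc : borel (fun s => g s - c) by exact: measurable_funB.
have := integral_sm_le x mgc mB ge.
have -> : (\int[mu (E B x)]_s (step_fun l s - g s) ^+ 2) =
   fine (\int[mu (E B x)]_s `|((g s - c) ^+ 2)%:E|)%E.
  congr fine; apply: eq_integral => s _.
  by rewrite lE /= ger0_norm ?sqr_ge0// -sqrrN opprB.
set I := (\int[_]_s _)%E => Ile; have I0 : (0 <= I)%E by exact: integral_ge0.
by rewrite -lee_fin fineK// ge0_fin_numE// (le_lt_trans Ile)// ltry.
Qed.

(** The isometry is extended to products of a step function with [h], and then the step function
    tends to [g]. That [h(A) y] lies in the domain of [g(A)] follows from boundedness of the
    approximants, by [sqintP]. *)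
Lemma fcalcM g h y : borel g -> borel h -> sqint E h y ->
  sqint E (fun s => g s * h s) y ->
  sqint E g (fcalc E h y) /\
  fcalc E g (fcalc E h y) = fcalc E (fun s => g s * h s) y.
Proof.
move=> mg mh ih igh; set gh := fun s => g s * h s; set w := fcalc E gh y.
have mgh : borel gh by exact: measurable_funM.
(* Only [h] is approximated here; multiplication by the bounded function [step_fun l] keeps
   everything dominated by [step_fun l * h]. *)
have key l : `|step_op E l (fcalc E h y) - w| ^+ 2 =
    \int[mu y]_s (step_fun l s * h s - gh s) ^+ 2.
  have mlh : borel (fun s => step_fun l s * h s).
    by apply: measurable_funM => //; exact: measurable_step_fun.
  have ilh : sqint E (fun s => step_fun l s * h s) y.
    have [M lM] := step_fun_bounded l.
    apply: (le_sqint (h := fun s => M * h s)) => //; last exact: sqintZ.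
    move=> s; rewrite !normrM ler_wpM2r// (le_trans (lM s))//.
    exact: ler_norm.
  have c1 : (fun n => `|step_op E l (step_op E (step_approx h n) y) - w| ^+ 2) @ \oo
      --> `|step_op E l (fcalc E h y) - w| ^+ 2.
    rewrite expr2; under eq_fun do rewrite expr2.
    suff c : (fun n => `|step_op E l (step_op E (step_approx h n) y) - w|) @ \oo
      --> `|step_op E l (fcalc E h y) - w| by exact: cvgM.
    apply: cvg_norm; apply: cvgB; last exact: cvg_cst.
    by apply: cvg_step_op; exact: fcalc_cvg.
  have c2 : (fun n => \int[mu y]_s (step_fun l s * step_fun (step_approx h n) s - gh s) ^+ 2)
      @ \oo --> \int[mu y]_s (step_fun l s * h s - gh s) ^+ 2.
    apply: (cvg_sqr_dist (h := fun s => step_fun l s * h s)) => //.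
    - by move=> n; apply: measurable_funM; exact: measurable_step_fun.
    - by move=> s; apply: cvgMr; have [] := step_approxP mh s.
    - move=> n s; rewrite !normrM ler_wpM2l//.
      by have [] := step_approxP mh s.
  move: c1; under eq_fun => n.
    rewrite -step_op_mul fcalc_dist//.
    under eq_Rintegral do rewrite step_fun_mul.
    over.
  by move=> c1; exact: (cvg_unique _ c1 c2).
have c : step_op E (step_approx g n) (fcalc E h y) @[n --> \oo] --> w.
  apply: cvg_sqr_norm; under eq_fun do rewrite key.
  rewrite -(Rintegral_sqr0 E y).
  have -> : \int[mu y]_s ((0:R) ^+ 2) = \int[mu y]_s ((gh s - gh s) ^+ 2).
    by apply: eq_Rintegral => s _; rewrite subrr.
  apply: (cvg_sqr_dist (h := gh)) => //.
  - by move=> n; apply: measurable_funM => //; exact: measurable_step_fun.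
  - by move=> s; apply: cvgMl; have [] := step_approxP mg s.
  - move=> n s; rewrite !normrM ler_wpM2r//.
    by have [] := step_approxP mg s.
split; last exact: cvg_lim c.
apply/(sqintP _ mg); have [M [_ hM]] := cvg_seq_bounded (cvgP _ c).
by exists (M + 1) => n; apply: hM => //; rewrite ltrDl.
Qed.

(** Since [E (C n)] is an orthogonal projection, [|E (C n) x - x|^2 = |x|^2 - |E (C n) x|^2], and
    continuity from below of the scalar measure applies. *)
Lemma cvg_sm_bigcup (C : (set (measurableTypeR R))^nat) x :
  (forall n, measurable (C n)) -> nondecreasing_seq C ->
  \bigcup_n C n = setT -> E (C n) x @[n --> \oo] --> x.
Proof.
move=> mC ndC CT; apply: cvg_sqr_norm.
have c : (fun n => mu x (C n)) @ \oo --> mu x setT.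
  by rewrite -CT; apply: nondecreasing_cvg_mu => //; rewrite CT.
have xE : mu x setT = (`|x| ^+ 2)%:E by rewrite scalar_measureE sm_setT.
have c' : (fun n => `|E (C n) x| ^+ 2) @ \oo --> `|x| ^+ 2.
  by rewrite xE in c; exact: (fine_cvg c).
have -> : (fun n => `|E (C n) x - x| ^+ 2) = (fun n => `|x| ^+ 2 - `|E (C n) x| ^+ 2).
  apply/funext => n; rewrite -normrN opprB sqr_normD normrN.
  by rewrite -scaleN1r innerZr innerC -sm_norm_inner//; lra.
by rewrite -(subrr (`|x| ^+ 2)); apply: cvgB => //; exact: cvg_cst.
Qed.

End FunctionalCalculusTheory.

(** * Spectral integrals *)

Section LocalToGlobal.
Context {R : realType}.

(** A Lindelöf argument: each point of [D] lies in an interval with rational endpoints on which the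
    comparison holds. There are countably many of these, and making them disjoint lets countable
    additivity sum the inequalities with the same [K]. *)
Lemma measure_le_local (mu nu : {measure set (measurableTypeR R) -> \bar R})
    (K : R) (D : set (measurableTypeR R)) : 0 <= K -> measurable D ->
  (forall s, D s -> exists2 e : R, 0 < e & forall B, measurable B ->
     B `<=` D -> B `<=` ball (s : R) e -> (mu B <= K%:E * nu B)%E) ->
  (mu D <= K%:E * nu D)%E.
Proof.
move=> K0 mD loc.
pose U (q : rat * rat) : set (measurableTypeR R) := D `&` `]ratr q.1, ratr q.2[.
pose good q := forall B, measurable B -> B `<=` U q -> (mu B <= K%:E * nu B)%E.
(* Enumerates all pairs of rationals; codes of no pair and pairs without the comparison property
   contribute the empty set. *)
pose W n : set (measurableTypeR R) :=
  if unpickle n is Some q then if `[< good q >] then U q else set0 else set0.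
have mW n : measurable (W n).
  rewrite /W; case: (unpickle n) => // q; case: ifP => // _.
  exact: measurableI.
have gW n B : measurable B -> B `<=` W n -> (mu B <= K%:E * nu B)%E.
  rewrite /W; case: (unpickle n) => [q|]; last first.
    by move=> _; rewrite subset0 => ->; rewrite !measure0 mule0.
  case: ifP => [/asboolP gq|_]; first exact: gq.
  by move=> _; rewrite subset0 => ->; rewrite !measure0 mule0.
have DW : D = \bigcup_n W n.
  apply/seteqP; split=> [s Ds|s [n _]]; last first.
    by rewrite /W; case: (unpickle n) => // q; case: ifP => // _ [].
  have [e e0 he] := loc s Ds.
  have [p pe] : exists p, ratr p \in `]s - e, s[ by apply: rat_in_itvoo; lra.
  have [q qe] : exists q, ratr q \in `]s, s + e[ by apply: rat_in_itvoo; lra.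
  move: pe qe; rewrite !in_itv/= => /andP[ep ps] /andP[sq qe].
  have gpq : good (p, q).
    move=> B mB BU; apply: he => // t /BU[]//=.
    rewrite in_itv/= => _ /andP[pt tq].
    by rewrite /ball/= ltr_norml; apply/andP; split; lra.
  have WU : W (pickle (p, q)) = U (p, q).
    by rewrite /W pickleK; case: asboolP.
  exists (pickle (p, q)); first exact: I.
  by rewrite WU; split=> //; rewrite /= in_itv/= ps.
have mV := seqDU_measurable mW.
have tV := @trivIset_seqDU _ W.
have VW n : seqDU W n `<=` W n by apply: subDsetl.
rewrite DW seqDU_bigcup_eq !measure_semi_bigcup//;
  [|exact: bigcup_measurable|exact: bigcup_measurable].
rewrite -nneseriesZl//; apply: lee_nneseries => // n _.
by apply: (gW n).
Qed.
End LocalToGlobal.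

Section SpectralIntegral.
Context {R : realType} {H : hilbertType R} (E : spectral_measure H).
Implicit Types (x y : H) (g h : R -> R) (B D : set (measurableTypeR R)).
Local Notation mu := (scalar_measure E).
Local Notation borel g := (measurable_fun [set: measurableTypeR R] g).

Lemma sqint_integrable g x : borel g -> sqint E g x ->
  (mu x).-integrable setT (EFin \o g).
Proof.
move=> mg ig; apply: (@le_Rintegrable _ _ _ (fun s => 1 + g s ^+ 2)) => //.
- move=> s; rewrite -(real_normK (num_real (g s))).
  by have := sqr_ge0 (1 - `|g s|); have := sqr_ge0 (`|g s|); lra.
- by apply: RintegrableD => //; exact: (integrable_cst E x 1).
Qed.

Lemma inner_step_opE l x y : inner (step_op E l x) y =
  4^-1 * (\int[mu (x + y)]_s step_fun l s - \int[mu (x - y)]_s step_fun l s).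
Proof.
have D : step_op E l (x + y) = step_op E l x + step_op E l y by exact: linearD.
have B : step_op E l (x - y) = step_op E l x - step_op E l y by exact: linearB.
rewrite -!inner_step_op D B innerBl !innerBr innerDl !innerDr.
by rewrite (innerC (step_op E l y) x) -(step_op_sym E l x y); field.
Qed.

Lemma inner_fcalc g x y : borel g -> sqint E g x -> sqint E g y ->
  inner (fcalc E g x) y =
  4^-1 * (\int[mu (x + y)]_s g s - \int[mu (x - y)]_s g s).
Proof.
move=> mg ix iy.
have ixy : sqint E g (x + y) by rewrite -[x]scale1r; exact: sqint_lin.
have ixNy : sqint E g (x - y) by rewrite addrC -scaleN1r; exact: sqint_lin.
have c1 : (fun n => inner (step_op E (step_approx g n) x) y) @ \oo -->
    inner (fcalc E g x) y.
  by apply: cvg_inner; [exact: fcalc_cvg|exact: cvg_cst].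
have c z : sqint E g z -> (fun n => \int[mu z]_s step_fun (step_approx g n) s) @ \oo -->
    \int[mu z]_s g s.
  move=> iz; apply: (@cvg_Rintegral _ _ _ _ (fun s => `|g s|)) => //.
  - by move=> n; exact: measurable_step_fun.
  - by move=> s; have [] := step_approxP mg s.
  - by move=> n s; have [] := step_approxP mg s.
  - by apply: integrable_norm; exact: sqint_integrable.
move: c1; under eq_fun do rewrite inner_step_opE.
move=> c1; apply: (cvg_unique _ c1) => //.
by apply: cvgMr; apply: cvgB; [exact: c ixy|exact: c ixNy].
Qed.

Lemma spectral_domE D g x : measurable D -> measurable_fun D g ->
  spectral_dom E D g x <-> sqint E (g \_ D) x.
Proof.
move=> mD mg; have mgD : borel (g \_ D) by apply/(measurable_restrictT _ mD).
rewrite /spectral_dom /= integral_mkcond.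
have -> : ((fun s => ((g s) ^+ 2)%:E) \_ D) =
          (fun s => `|(((g \_ D) s) ^+ 2)%:E|%E).
  apply/funext => s; rewrite !patchE; case: ifPn => _ /=.
    by rewrite ger0_norm ?sqr_ge0.
  by rewrite expr0n/= normr0.
split=> [h|/integrableP[]//]; apply/integrableP; split => //.
by apply/measurable_EFinP; exact: measurable_funX.
Qed.

Lemma measurable_bounded_level g n : borel g ->
  measurable [set s : measurableTypeR R | `|g s| <= n%:R].
Proof.
move=> mg; rewrite -[X in measurable X]setTI.
have : borel (Num.norm \o g) by exact: measurableT_comp.
by move=> /(_ measurableT `]-oo, n%:R]%classic (measurable_itv _)).
Qed.

Lemma bounded_level_cvg g x : borel g ->
  E [set s | `|g s| <= n%:R] x @[n --> \oo] --> x.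
Proof.
move=> mg; apply: cvg_sm_bigcup.
- by move=> n; exact: measurable_bounded_level.
- move=> m n mn; apply/subsetPset => s /= /le_trans; apply.
  by rewrite ler_nat.
- apply/seteqP; split=> // s _; exists (Num.truncn `|g s|).+1 => //=.
  exact/ltW/truncnS_gt.
Qed.

(** [fcalc] satisfies the weak identity that defines [spectral_integral]. For uniqueness, the
    difference [z] of two solutions is tested against its own truncations to the sets where [|g|] is
    at most [n]: they lie in the domain and converge to [z]. *)
Lemma spectral_integralE D g x : measurable D -> measurable_fun D g ->
  spectral_dom E D g x -> spectral_integral E D g x = fcalc E (g \_ D) x.
Proof.
move=> mD mg dx; have mgD : borel (g \_ D) by apply/(measurable_restrictT _ mD).
have ix := (spectral_domE x mD mg).1 dx.
have formE y : spectral_dom E D g y -> inner (fcalc E (g \_ D) x) y = spectral_form E D g x y.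
  move=> /(spectral_domE y mD mg) iy.
  by rewrite inner_fcalc// /spectral_form -!Rintegral_mkcond.
apply: xget_unique => //= w hw.
apply/eqP; rewrite -subr_eq0; set z := w - _.
have zC n : E [set s | `|(g \_ D) s| <= n%:R] z = 0.
  have mC := measurable_bounded_level n mgD.
  apply/eqP; rewrite -normr_eq0 -sqrf_eq0 sm_norm_inner// innerC /z.
  set y := E _ _.
  have dy : spectral_dom E D g y.
    by apply/spectral_domE => //; exact: (@sqint_bounded_on _ _ _ _ _ _ n%:R).
  by rewrite innerBl hw// formE// subrr.
have := bounded_level_cvg (x := z) mgD.
under eq_fun do rewrite zC.
by move=> /(cvg_unique _ (cvg_cst _)) => <-.
Qed.

(** Adding [m] to the scaled approximants of [h] gives approximants of the sum whose error is
    exactly [a] times that of [h]. *)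
Lemma fcalc_step_add m a h x : borel h -> sqint E h x ->
  fcalc E (fun s => step_fun m s + a * h s) x = step_op E m x + a *: fcalc E h x.
Proof.
move=> mh ih; set g := (fun s => _).
have mm : borel (step_fun m) by exact: measurable_step_fun.
have mg : borel g by apply: measurable_funD => //; exact: measurable_funM.
have ig : sqint E g x.
  apply: sqintD => //; [exact: measurable_funM|exact: sqint_step_fun|exact: sqintZ].
have c : step_op E (m ++ step_scale a (step_approx h n)) x @[n --> \oo] --> fcalc E g x.
  apply: fcalc_unique => //.
  under eq_fun => n.
    under eq_Rintegral => s _ do
      rewrite step_fun_cat step_fun_scale opprD addrACA subrr add0r -mulrBr exprMn.
    rewrite RintegralZl//; last first.
      apply: sqintB => //; [exact: measurable_step_fun|exact: sqint_step_fun].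
    over.
  rewrite -(mulr0 (a ^+ 2)); apply: cvgMr; exact: cvg_step_approx_dist.
move: c; under eq_fun do rewrite step_op_cat step_op_scale.
move=> c; apply: (cvg_unique _ c) => //.
by apply: cvgD; [exact: cvg_cst|apply: cvgZr; exact: fcalc_cvg].
Qed.

End SpectralIntegral.

(** * The spectrum as the support of the spectral measure *)

Section SpectrumSupport.
Context {R : realType} {H : hilbertType R} (A : operator H) (E : spectral_measure H).
Hypothesis AE : is_spectral_measure_of A E.
Implicit Types (x y : H) (B : set (measurableTypeR R)).
Local Notation mu := (scalar_measure E).
Local Notation borel g := (measurable_fun [set: measurableTypeR R] g).

Let borel_id : borel (@id R).
Proof. exact: measurable_id. Qed.

Let patch_setT (g : R -> R) : g \_ setT = g.
Proof. by apply/funext => s; rewrite patchT// inE. Qed.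

Let op_domE x : op_dom A x <-> sqint E id x.
Proof.
by rewrite AE.1 -[X in sqint E X]patch_setT -spectral_domE.
Qed.

Let op_appE x : op_dom A x -> A x = fcalc E id x.
Proof.
move=> dx; rewrite AE.2// -[X in fcalc E X]patch_setT -spectral_integralE//.
by move: dx; rewrite AE.1.
Qed.

(** If the resolvent is bounded by [M], then on the range of [E B], with [B] within [1 / (2 M)] of
    [l], the operator [A - l] has norm at most [1 / (2 M)]. Hence [|y| <= |y| / 2] there. *)
Lemma resolvent_set_null (l : R) : resolvent_set A l ->
  exists2 e : R, 0 < e & forall B, measurable B -> B `<=` ball l e ->
    forall x, E B x = 0.
Proof.
move=> [G [Gc _ GA]].
have : bounded_near G (nbhs (0 : H)) by apply: continuous_linear_bounded; exact: Gc.
move=> /linear_boundedP /pinfty_ex_gt0 [M M0 GM].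
exists (2 * M)^-1; first by rewrite invr_gt0 mulr_gt0.
move=> B mB Bl x; set e := (2 * M)^-1; set y := E B x.
have e0 : 0 < e by rewrite invr_gt0 mulr_gt0.
have Bid s : B s -> `|s - l| <= e.
  by move=> /Bl; rewrite /ball/= distrC => /ltW.
have dy : op_dom A y.
  apply/op_domE; apply: (@sqint_bounded_on _ _ _ _ _ _ (e + `|l|)) => // s /Bid sl.
  by rewrite -(subrK l s) (le_trans (ler_normD _ _))// lerD.
have Ay : `|A y - l *: y| <= e * `|y|.
  by rewrite op_appE//; apply: fcalc_near => //; exact: ltW.
have := GM (A y - l *: y); rewrite GA// => yM.
have : `|y| <= M * (e * `|y|) by rewrite (le_trans yM)// ler_pM2l.
rewrite mulrA (_ : M * e = 2^-1); last by rewrite /e invfM mulrCA divff ?mulr1// gt_eqF.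
move=> h; apply/eqP; rewrite -normr_eq0 eq_le normr_ge0 andbT; lra.
Qed.

(** The resolvent is the function [1 / (s - l)] of [A], cut off on the null ball so that it is
    bounded by [1 / e]. *)
Lemma null_resolvent_set (l e : R) : 0 < e -> (forall x, E (ball l e) x = 0) ->
  resolvent_set A l.
Proof.
move=> e0 El.
pose D : set (measurableTypeR R) := ~` ball l e.
have mb : measurable (ball l e : set (measurableTypeR R)).
  by apply: open_measurable; exact: ball_open.
have mD : measurable D by exact: measurableC.
have ED x : E D x = x.
  have := smU E x mb mD; rewrite El add0r => <-; first by rewrite setUCr sm_setT.
  by apply/disj_set2P; exact: setICr.
pose h : R -> R := (fun s => (s - l)^-1) \_ D.
have Dl s : D s -> e <= `|s - l|.
  by move=> Ds; rewrite leNgt; apply/negP => sl; apply: Ds; rewrite /ball/= distrC.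
have mh : borel h.
  apply/(measurable_restrictT _ mD); apply: subspace_continuous_measurable_fun => //.
  apply: continuous_in_subspaceT => s /set_mem Ds.
  apply: cvgV; last by apply: cvgB; [exact: cvg_id|exact: cvg_cst].
  by rewrite -normr_gt0 (lt_le_trans e0)// Dl.
have he s : `|h s| <= e^-1.
  rewrite /h patchE; case: ifPn => [/set_mem Ds|_]; last by rewrite normr0 invr_ge0 ltW.
  by rewrite normfV lef_pV2 ?posrE ?Dl// (lt_le_trans e0)// Dl.
have ih x : sqint E h x.
  by rewrite -[x](sm_setT E); exact: (@sqint_bounded_on _ _ _ _ _ _ e^-1).
pose one : @mset R := exist measurable D mD.
(* The identity [s / (s - l) = 1 + l / (s - l)] off the ball. The indicator of [D] acts as the
   identity, so this yields both resolvent equations. *)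
have idh s : s * h s = step_fun [:: (1, one)] s + l * h s.
  rewrite /step_fun big_seq1/= mul1r /h patchE indicE.
  case: (boolP (s \in D)) => [Ds|_]; last by rewrite !mulr0 addr0.
  have : s - l != 0 by rewrite -normr_gt0 (lt_le_trans e0)// Dl//; exact: set_mem.
  by move=> sl; rewrite /=; field.
have op1 x : step_op E [:: (1, one)] x = x by rewrite /step_op big_seq1/= scale1r ED.
have iidh x : sqint E (fun s => s * h s) x.
  under [X in sqint E X]eq_fun do rewrite idh.
  apply: sqintD => //; [exact: measurable_step_fun|exact: measurable_funM|exact: sqint_step_fun|exact: sqintZ].
have cidh x : fcalc E (fun s => s * h s) x = x + l *: fcalc E h x.
  under [X in fcalc E X]eq_fun do rewrite idh.
  by rewrite fcalc_step_add// op1.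
have lin : linear (fcalc E h) by move=> a x y; exact: fcalc_lin.
pose G : {linear H -> H} := HB.pack (fcalc E h) (GRing.isLinear.Build _ _ _ _ _ lin).
exists G; split.
- apply: (@linear_bound_continuous _ _ _ _ e^-1) => x.
  have := @fcalc_near _ _ E h setT x 0 e^-1 mh measurableT.
  rewrite sm_setT scale0r subr0; apply; first by rewrite invr_ge0 ltW.
  by move=> s _; rewrite subr0.
- move=> y; have [iG GE] := fcalcM borel_id mh (ih y) (iidh y).
  have dG : op_dom A (G y) by apply/op_domE.
  by split=> //; rewrite op_appE//= GE cidh addrK.
- move=> x dx; have ix := (op_domE x).1 dx.
  have hid : (fun s => h s * s) = (fun s => s * h s) by apply/funext => s; rewrite mulrC.
  have [_ hE] : sqint E h (fcalc E id x) /\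
      fcalc E h (fcalc E id x) = fcalc E (fun s => h s * s) x.
    by apply: fcalcM => //; rewrite hid.
  rewrite linearB linearZ /= op_appE// hE hid cidh addrK//.
Qed.

Lemma closed_spectrum : closed (spectrum A).
Proof.
rewrite /spectrum closedC openE => l /resolvent_set_null[e e0 Ee].
exists e => // m ml.
have d0 : 0 < e - `|l - m| by rewrite subr_gt0.
apply: (null_resolvent_set d0) => x; apply: Ee.
  by apply: open_measurable; exact: ball_open.
move=> s; rewrite /ball/= => ms.
by rewrite -(subrK m l) -addrA (le_lt_trans (ler_normD _ _))// -ltrBrDl.
Qed.

Lemma measurable_spectrum : measurable (spectrum A : set (measurableTypeR R)).
Proof. by apply: closed_measurable; exact: closed_spectrum. Qed.

Lemma sm_spectrum x : E (spectrum A) x = x.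
Proof.
have mS := measurable_spectrum.
have mr : measurable (~` spectrum A : set (measurableTypeR R)) by exact: measurableC.
(* The resolvent set is covered by null balls; local comparison with constant 0 passes to a
   countable subcover. *)
have r0 : (mu x (~` spectrum A) <= 0%:E * mu x (~` spectrum A))%E.
  apply: measure_le_local => // s; rewrite /spectrum setCK => /resolvent_set_null[e e0 Ee].
  exists e => // B mB _ Bs.
  by rewrite /= !scalar_measureE Ee// normr0 expr0n/= mule0.
have E0 : E (~` spectrum A) x = 0.
  apply/eqP; rewrite -normr_eq0 -sqrf_eq0 eq_le sqr_ge0 andbT.
  by move: r0; rewrite mul0e [mu x _]scalar_measureE lee_fin.
rewrite -[RHS](sm_setT E) -(setUCr (spectrum A)) smU// ?E0 ?addr0//.
by apply/disj_set2P; exact: setICr.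
Qed.

End SpectrumSupport.

(** * Right derivatives and quadratic forms *)

Section RightDerivative.
Context {R : realType}.

Lemma near_right0 (P : R -> Prop) : (\forall h \near (0:R)^'+, P h) ->
  exists2 d : R, 0 < d & forall h, 0 < h < d -> P h.
Proof.
rewrite near_withinE near_simpl => /nbhs_ballP[d /= d0 dP].
exists d => // h /andP[h0 hd]; apply: dP => //.
by rewrite /ball/= sub0r normrN gtr0_norm.
Qed.

Definition rderiv (V : normedModType R) (u : R -> V) (t : R) (v : V) :=
  h^-1 *: (u (t + h) - u t) @[h --> (0:R)^'+] --> v.

Lemma cvg_right_id : h @[h --> (0:R)^'+] --> (0:R).
Proof. by apply: cvg_within_filter; exact: cvg_id. Qed.

Lemma rderiv_cvg (V : normedModType R) (u : R -> V) t v : rderiv u t v ->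
  u (t + h) @[h --> (0:R)^'+] --> u t.
Proof.
move=> uv.
have c : h *: (h^-1 *: (u (t + h) - u t)) + u t @[h --> (0:R)^'+] --> 0 *: v + u t.
  apply: cvgD; last exact: cvg_cst.
  by apply: cvgZ => //; exact: cvg_right_id.
rewrite scale0r add0r in c; apply: cvg_trans c; apply: near_eq_cvg.
near=> h; have h0 : h != 0 by rewrite gt_eqF//; near: h; exact: nbhs_right_gt.
by rewrite scalerA divff// scale1r subrK.
Unshelve. all: by end_near. Qed.

Lemma rderivD (V : normedModType R) (u w : R -> V) t u' w' :
  rderiv u t u' -> rderiv w t w' -> rderiv (fun s => u s + w s) t (u' + w').
Proof.
move=> uu' ww'; rewrite /rderiv.
under eq_fun do rewrite opprD addrACA scalerDr.
exact: cvgD.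
Qed.

Lemma rderivM (u w : R -> R^o) t (u' w' : R) :
  rderiv u t u' -> rderiv w t w' ->
  rderiv (fun s => (u s * w s : R^o)) t (u' * w t + u t * w').
Proof.
move=> uu' ww'; rewrite /rderiv.
have -> : (fun h => h^-1 *: (u (t + h) * w (t + h) - u t * w t : R^o)) =
  (fun h => h^-1 *: (u (t + h) - u t) * w (t + h) + u t * (h^-1 *: (w (t + h) - w t))).
  by apply/funext => h; rewrite /GRing.scale/=; ring.
apply: cvgD; apply: cvgM => //; [exact: rderiv_cvg ww'|exact: cvg_cst].
Qed.

Lemma rderiv_inner (H : hilbertType R) (u w : R -> H) t (u' w' : H) :
  rderiv u t u' -> rderiv w t w' ->
  rderiv (fun s => (inner (u s) (w s) : R^o)) t (inner u' (w t) + inner (u t) w').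
Proof.
move=> uu' ww'; rewrite /rderiv.
have -> : (fun h => h^-1 *: (inner (u (t + h)) (w (t + h)) - inner (u t) (w t) : R^o)) =
  (fun h => inner (h^-1 *: (u (t + h) - u t)) (w (t + h)) +
            inner (u t) (h^-1 *: (w (t + h) - w t))).
  apply/funext => h; rewrite innerZl innerZr innerBl innerBr /GRing.scale/=; ring.
by apply: cvgD; apply: cvg_inner => //; [exact: rderiv_cvg ww'|exact: cvg_cst].
Qed.

Lemma rderiv_expR (c t : R) :
  rderiv (fun s => (expR (c * s) : R^o)) t (c * expR (c * t)).
Proof.
have : is_derive t 1 (fun s : R => expR (c * s)) (c * expR (c * t)).
  apply: is_derive_eq; rewrite /GRing.scale/=; ring.
move=> [ex <-]; rewrite /rderiv; apply: cvg_dnbhs_at_right.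
rewrite /derive; apply: cvg_trans ex; apply: near_eq_cvg.
by apply: nearW => h /=; rewrite (addrC t) {2}/GRing.scale/= mulr1.
Qed.

(** Continuous induction on [G s <= G 0 + n s], with a small slope [n > 0]. Left continuity carries
    the inequality to the supremum of the times up to which it holds; the right derivative, being
    below [n], carries it beyond. *)
Lemma nonincreasing_rderiv (G g : R -> R^o) (T : R) : 0 <= T ->
  (forall t, 0 <= t -> rderiv G t (g t)) -> (forall t, 0 <= t -> g t <= 0) ->
  (forall t, 0 < t -> G (t - h) @[h --> (0:R)^'+] --> G t) ->
  G T <= G 0.
Proof.
move=> T0 Gg g0 Gleft; apply/ler_addgt0Pr => e e0.
(* Chosen so that [n T <= e]; the 1 keeps the denominator positive when [T = 0]. *)
pose n := e / (T + 1).
have n0 : 0 < n by rewrite divr_gt0// ltr_wpDl.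
apply: (@le_trans _ _ (G 0 + n * T)); last first.
  by rewrite lerD2l /n mulrAC ler_pdivrMr ?ltr_wpDl// ler_pM2l// lerDl.
apply: contrapT => /negP; rewrite -ltNge => GT.
pose Z := [set t | 0 <= t <= T /\ forall s, 0 <= s <= t -> G s <= G 0 + n * s].
have Z0 : Z 0.
  split; first by rewrite lexx T0.
  move=> s /andP[s0 s1]; have -> : s = 0 by apply/le_anti; rewrite s0 s1.
  by rewrite mulr0 addr0.
have Zub : has_ubound Z by exists T => t [/andP[]].
pose c := sup Z.
have c0 : 0 <= c by exact: ub_le_sup Zub _ Z0.
have cT : c <= T by apply: ge_sup; [exists 0|move=> t [/andP[]]].
have Zlt s : 0 <= s < c -> G s <= G 0 + n * s.
  move=> /andP[s0 sc].
  have hZ : has_sup Z by split => //; exists 0.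
  have [t [_ tZ] st] := sup_adherent (eps := c - s) (ltac:(lra)) hZ.
  by apply: tZ; rewrite s0 ltW//; move: st; rewrite -/c; lra.
have Zc s : 0 <= s <= c -> G s <= G 0 + n * s.
  move=> /andP[s0]; rewrite le_eqVlt => /predU1P[->|sc]; last by apply: Zlt; rewrite s0.
  move: c0; rewrite le_eqVlt => /predU1P[<-|c0]; first by rewrite mulr0 addr0.
  have cl : G (c - h) - n * (c - h) @[h --> (0:R)^'+] --> G c - n * (c - 0).
    apply: cvgB; first exact: Gleft.
    by apply: cvgMr; apply: cvgB; [exact: cvg_cst|exact: cvg_right_id].
  rewrite subr0 in cl; rewrite -lerBlDr.
  apply: (cvgr_to_le cl); near=> h.
  rewrite lerBlDr; apply: Zlt; apply/andP; split.
  - by rewrite subr_ge0 ltW//; near: h; exact: nbhs_right_lt.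
  - by rewrite ltrBlDr ltrDl; near: h; exact: nbhs_right_gt.
have cltT : c < T.
  rewrite lt_neqAle cT andbT; apply/eqP => cE.
  by move: GT; rewrite ltNge Zc// -cE c0 lexx.
have : \forall h \near (0:R)^'+, h^-1 *: (G (c + h) - G c) < n.
  apply: (cvgr_lt (g c)); first exact: Gg.
  by rewrite (le_lt_trans (g0 _ _)).
move=> /near_right0[d d0 hd].
pose k := Num.min (d / 2) ((T - c) / 2).
have k0 : 0 < k by rewrite lt_min; apply/andP; split; lra.
have kd : k <= d / 2 by rewrite ge_min lexx.
have kT : k <= (T - c) / 2 by rewrite ge_min lexx orbT.
have : Z (c + k).
  split; first by apply/andP; split; lra.
  move=> s /andP[s0 sk]; have [sc|sc] := leP s c; first by apply: Zc; rewrite s0.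
  have := hd (s - c); rewrite (_ : c + (s - c) = s); last by ring.
  rewrite /GRing.scale/= mulrC ltr_pdivrMr; last by lra.
  move=> /(_ ltac:(apply/andP; split; lra)).
  have := Zc c; rewrite c0 lexx => /(_ isT); lra.
move=> /(ub_le_sup Zub); rewrite -/c; lra.
Unshelve. all: by end_near. Qed.

Lemma rderiv_gronwall (Q q : R -> R^o) (c T : R) : 0 <= T ->
  (forall t, 0 <= t -> rderiv Q t (q t)) -> (forall t, 0 <= t -> q t <= c * Q t) ->
  (forall t, 0 < t -> Q (t - h) @[h --> (0:R)^'+] --> Q t) ->
  Q T <= expR (c * T) * Q 0.
Proof.
move=> T0 Qq qc Qleft.
pose G s : R^o := Q s * expR (- c * s).
have : G T <= G 0.
  apply: (@nonincreasing_rderiv G (fun t => q t * expR (- c * t) + Q t * (- c * expR (- c * t)))) => //.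
  - by move=> t t0; apply: rderivM; [exact: Qq|exact: rderiv_expR].
  - move=> t t0; rewrite mulrA -mulrDl pmulr_lle0 ?expR_gt0//.
    by have := qc t t0; lra.
  - move=> t t0; apply: cvgM; first exact: Qleft.
    have cc : - c * (t - h) @[h --> (0:R)^'+] --> - c * (t - 0).
      by apply: cvgMr; apply: cvgB; [exact: cvg_cst|exact: cvg_right_id].
    rewrite subr0 in cc.
    exact: (cvg_comp _ _ cc (@continuous_expR R _)).
rewrite /G mulr0 expR0 mulr1 mulNr expRN ler_pdivrMr ?expR_gt0//.
by rewrite mulrC.
Qed.

End RightDerivative.

(** * The Lyapunov form of the damped oscillator *)

Section Lyapunov.
Context {R : realType} {H : hilbertType R}.
Implicit Types (P V : H) (a b c : R).

Lemma quadratic_form_ge0 P V a b c : 0 <= a -> 0 <= c -> b ^+ 2 <= a * c ->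
  0 <= a * `|P| ^+ 2 + 2 * b * inner P V + c * `|V| ^+ 2.
Proof.
rewrite le_eqVlt => /predU1P[<-|a0] c0.
  rewrite mul0r => b2; have -> : b = 0.
    by apply/eqP; rewrite -sqrf_eq0 eq_le b2 sqr_ge0.
  by rewrite mul0r mulr0 mul0r !add0r mulr_ge0// sqr_ge0.
move=> bac; rewrite -(pmulr_rge0 _ a0).
have -> : a * (a * `|P| ^+ 2 + 2 * b * inner P V + c * `|V| ^+ 2) =
  `|a *: P + b *: V| ^+ 2 + (a * c - b ^+ 2) * `|V| ^+ 2.
  by rewrite sqr_normD innerZl innerZr !normrZ !exprMn !real_normK ?num_real//; ring.
by rewrite addr_ge0 ?sqr_ge0// mulr_ge0 ?sqr_ge0// subr_ge0.
Qed.

Definition lyap k P V : R := `|P| ^+ 2 + `|V| ^+ 2 + 2 * k * inner P V.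

Lemma lyap_ge k P V : 0 <= k -> (1 - k) * (`|P| ^+ 2 + `|V| ^+ 2) <= lyap k P V.
Proof.
move=> k0; rewrite -subr_ge0.
have -> : lyap k P V - (1 - k) * (`|P| ^+ 2 + `|V| ^+ 2) = k * `|P + V| ^+ 2.
  by rewrite /lyap sqr_normD; ring.
by rewrite mulr_ge0// sqr_ge0.
Qed.

Lemma lyap_le k P V : 0 <= k -> lyap k P V <= (1 + k) * (`|P| ^+ 2 + `|V| ^+ 2).
Proof.
move=> k0; rewrite -subr_ge0.
have -> : (1 + k) * (`|P| ^+ 2 + `|V| ^+ 2) - lyap k P V = k * `|P - V| ^+ 2.
  by rewrite /lyap sqr_normD normrN innerNr; ring.
by rewrite mulr_ge0// sqr_ge0.
Qed.

(** The derivative of [lyap k] along a curve through [(P, V)] with velocity [(P', V')]. *)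
Definition lyap' k P V P' V' : R :=
  2 * inner P P' + 2 * inner V V' + 2 * k * (inner P' V + inner P V').

(** With [x = k sg - f], the right side minus the left side is a quadratic form with diagonal
    coefficients [2 ((f - r) + x)] and [2 ((f - r) - x)] and mixed coefficient [2 k (f - r)]. The
    last hypothesis is its discriminant condition. *)
Lemma lyap'_oscillator k sg f r P V : 0 <= k -> r <= f ->
  (k * sg - f) ^+ 2 <= (1 - k ^+ 2) * (f - r) ^+ 2 ->
  lyap' k P V (sg *: V) (- (sg *: P) - (2 * f) *: V) <= - (2 * r) * lyap k P V.
Proof.
move=> k0 rf x2; set x := k * sg - f in x2.
have xr : x ^+ 2 <= (f - r) ^+ 2.
  apply: (le_trans x2); rewrite ler_piMl ?sqr_ge0//; have := sqr_ge0 k; lra.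
have : `|x| <= f - r.
  by rewrite -(@ler_pXn2r _ 2) ?nnegrE ?subr_ge0// real_normK ?num_real.
rewrite ler_norml => /andP[x1 x3].
have := @quadratic_form_ge0 P V (2 * (x + (f - r))) (2 * k * (f - r)) (2 * ((f - r) - x)).
move=> /(_ ltac:(lra) ltac:(lra) ltac:(nra)) h.
rewrite -subr_ge0; apply: le_trans h _; rewrite le_eqVlt; apply/orP; left; apply/eqP.
rewrite /lyap /lyap' /x !innerBr !innerNr !innerZr !innerZl.
by rewrite !sqr_norm_inner (innerC V P); ring.
Qed.

Lemma lyap'_perturbation (k e : R) P V P0 V0 P1 V1 : 0 <= k <= 1 ->
  `|P1 - P0| <= e * (`|P| + `|V|) -> `|V1 - V0| <= e * (`|P| + `|V|) ->
  lyap' k P V P1 V1 <= lyap' k P V P0 V0 + 8 * e * (`|P| ^+ 2 + `|V| ^+ 2).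
Proof.
move=> /andP[k0 k1] hP hV.
have bnd (X Y : H) : `|Y| <= e * (`|P| + `|V|) -> inner X Y <= `|X| * (e * (`|P| + `|V|)).
  move=> hY; apply: le_trans (ler_norm _) _; apply: le_trans (inner_le _ _) _.
  by rewrite ler_wpM2l.
have h1 := bnd P _ hP; have h2 := bnd V _ hV.
have h3 := bnd V _ hP; have h4 := bnd P _ hV.
have h34 : k * (inner V (P1 - P0) + inner P (V1 - V0)) <=
    `|V| * (e * (`|P| + `|V|)) + `|P| * (e * (`|P| + `|V|)).
  apply: (@le_trans _ _ (k * (`|V| * (e * (`|P| + `|V|)) + `|P| * (e * (`|P| + `|V|))))).
    by rewrite ler_wpM2l// lerD.
  rewrite ler_piMl// addr_ge0// mulr_ge0//; exact: le_trans (normr_ge0 _) hP.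
have e0 : 0 <= e * (`|P| + `|V|) by exact: le_trans (normr_ge0 _) hP.
(* Cauchy-Schwarz and [k <= 1] produce the left side. The sign of [e] is read off from the bounds
   when [P] or [V] is nonzero; otherwise both sides vanish. *)
have : 4 * e * (`|P| + `|V|) ^+ 2 <= 8 * e * (`|P| ^+ 2 + `|V| ^+ 2).
  have [S0|S0] := eqVneq (`|P| + `|V|) 0.
    have P0' : `|P| = 0 by have := normr_ge0 P; have := normr_ge0 V; lra.
    have V0' : `|V| = 0 by have := normr_ge0 P; have := normr_ge0 V; lra.
    by rewrite P0' V0'; lra.
  have ee : 0 <= e by rewrite -(pmulr_lge0 (x := `|P| + `|V|))// lt_neqAle eq_sym S0 addr_ge0.
  have := mulr_ge0 ee (sqr_ge0 (`|P| - `|V|)); lra.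
move: h1 h2 h34; rewrite /lyap' !innerBr (innerC P1 V) (innerC P0 V); lra.
Qed.

End Lyapunov.

(** * Decay rates *)

Section DecayRates.
Context {R : realType}.
Implicit Types (sg f q r m : R).

(** The last inequality is the discriminant condition of [lyap'_oscillator], so [lyap k] decays at
    rate [2 r]; the bound on [k] keeps it comparable with the energy, with constants depending only
    on [q]. *)
Definition rate_ok sg f q r := exists k : R,
  [/\ 0 <= k, k ^+ 2 <= 1 - q ^+ 2, r <= f &
      (k * sg - f) ^+ 2 <= (1 - k ^+ 2) * (f - r) ^+ 2].

Lemma rate_okP sg f q r : 0 < sg -> 0 < f -> 0 < q <= 1 ->
  (f <= sg -> r <= f) -> (sg < f -> r <= f - Num.sqrt (f ^+ 2 - sg ^+ 2)) ->
  (Num.sqrt (1 - q ^+ 2) * sg < f -> Num.sqrt (1 - q ^+ 2) * f < sg ->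
    r <= f * (1 - q)) ->
  rate_ok sg f q r.
Proof.
move=> sg0 f0 /andP[q0 q1] rle rgt rnear; set k := Num.sqrt (1 - q ^+ 2) in rnear *.
have k0 : 0 <= k by exact: sqrtr_ge0.
have q2 : 0 <= 1 - q ^+ 2 by rewrite subr_ge0 expr_le1// ltW.
have k2 : k ^+ 2 = 1 - q ^+ 2 by rewrite sqr_sqrtr.
(* Away from [f = sg] on the small damping side, [f / sg] is at most the cutoff [k], and it makes
   [k * sg - f] zero. *)
have [fk|fk] := leP f (k * sg).
  have fsg : f <= sg.
    rewrite (le_trans fk)// ler_piMl ?(ltW sg0)//.
    by rewrite -(@ler_pXn2r _ 2) ?nnegrE// k2 expr1n gerBl sqr_ge0.
  exists (f / sg); split.
  - by rewrite divr_ge0 ?(ltW sg0) ?(ltW f0).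
  - rewrite -k2 lerXn2r ?nnegrE ?divr_ge0 ?(ltW sg0) ?(ltW f0)//.
    by rewrite ler_pdivrMr.
  - exact: rle.
  - rewrite divfK ?gt_eqF// subrr expr0n/= mulr_ge0 ?sqr_ge0// subr_ge0.
    by rewrite expr_le1 ?divr_ge0 ?(ltW sg0) ?(ltW f0)// ler_pdivrMr// mul1r.
(* On the large damping side [sg / f] is at most the cutoff. With [w^2 = f^2 - sg^2], the condition
   reduces to [w <= f - r]. *)
have [sk|sk] := leP sg (k * f).
  have sgf : sg < f \/ sg = f.
    have : sg <= f.
      rewrite (le_trans sk)// ler_piMl ?(ltW f0)//.
      by rewrite -(@ler_pXn2r _ 2) ?nnegrE// k2 expr1n gerBl sqr_ge0.
    by rewrite le_eqVlt => /predU1P[|]; [right|left].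
  case: sgf => [sgf|sgf]; last first.
    by move: sk; rewrite sgf => sk; exfalso; move: fk; rewrite sgf; lra.
  set w := Num.sqrt (f ^+ 2 - sg ^+ 2) in rgt.
  have w0 : 0 <= w by exact: sqrtr_ge0.
  have w2 : w ^+ 2 = f ^+ 2 - sg ^+ 2.
    by rewrite sqr_sqrtr// subr_ge0 lerXn2r ?nnegrE ?(ltW sg0) ?(ltW f0) ?(ltW sgf).
  have fr : w <= f - r by have := rgt sgf; lra.
  exists (sg / f); split.
  - by rewrite divr_ge0 ?(ltW sg0) ?(ltW f0).
  - rewrite -k2 lerXn2r ?nnegrE ?divr_ge0 ?(ltW sg0) ?(ltW f0)//.
    by rewrite ler_pdivrMr.
  - by have := rgt sgf; lra.
  - have -> : sg / f * sg - f = - (w ^+ 2 / f) by rewrite w2; field; rewrite gt_eqF.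
    have -> : 1 - (sg / f) ^+ 2 = (w / f) ^+ 2 by rewrite !expr_div_n w2; field; rewrite gt_eqF.
    have wf0 : 0 <= w / f by rewrite divr_ge0 ?(ltW f0).
    have -> : w ^+ 2 / f = w / f * w by ring.
    have fr0 : 0 <= f - r by exact: le_trans fr.
    rewrite sqrrN -exprMn lerXn2r ?nnegrE ?(mulr_ge0 wf0)//.
    by rewrite ler_wpM2l.
(* In the remaining region the cutoff itself is used: [0 <= f - k sg <= f - k^2 f = q^2 f <= q (f -
   r)]. *)
have rf := rnear fk sk; exists k; split => //; first by rewrite k2.
  by rewrite (le_trans rf)// ler_piMr ?(ltW f0)// gerBl ltW.
have -> : 1 - k ^+ 2 = q ^+ 2 by rewrite k2; ring.
rewrite -exprMn -sqrrN lerXn2r ?nnegrE//.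
- by rewrite opprB subr_ge0 ltW.
- by rewrite mulr_ge0 ?(ltW q0)// subr_ge0 (le_trans rf)// ler_piMr ?(ltW f0)// gerBl ltW.
- apply: (@le_trans _ _ (q ^+ 2 * f)).
    have : k * (k * f) <= k * sg by apply: ler_wpM2l; lra.
    by rewrite mulrA -expr2 k2; lra.
  rewrite expr2 -mulrA ler_wpM2l ?(ltW q0)//; lra.
Qed.

(** The premises on [q] force [f s] to be close to [sqrt s]. For large [s] this makes [f s] at least
    [2 m]. On the compact rest, [f s] close to [sqrt s] implies, by nonresonance and continuity,
    that [f s] exceeds [m] by a fixed amount. *)
Lemma nonresonant_gap (D : set R) (f : R -> R) m : closed D ->
  {within D, continuous f} -> 0 <= m ->
  (forall s, D s -> 0 < s) -> (forall s, D s -> 0 < f s) ->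
  (forall s, D s -> f s = Num.sqrt s -> m < f s) ->
  exists2 q, 0 < q <= 1 & forall s, D s ->
    Num.sqrt (1 - q ^+ 2) * Num.sqrt s < f s ->
    Num.sqrt (1 - q ^+ 2) * f s < Num.sqrt s -> m <= f s * (1 - q).
Proof.
move=> cD cf m0 D0 f0 res.
(* Beyond [M] one has [sqrt s >= 4 m]; two factors [1 / 2], one from the cutoff and one from
   [1 - q], still leave [m]. The added 1 makes [M] positive. *)
pose M : R := (4 * m) ^+ 2 + 1.
have M0 : 0 < M by rewrite ltr_wpDl ?sqr_ge0.
have [d d0 hd] : exists2 d : R, 0 < d & forall s, D s -> s <= M ->
    d <= `|f s - Num.sqrt s| \/ d <= f s - m.
  pose K := D `&` `[0, M]%classic.
  have [K0|/set0P KN0] := eqVneq K set0.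
    exists 1 => // s Ds sM; have : K s by split=> //=; rewrite in_itv/= sM ltW ?D0.
    by rewrite K0.
  have cK : compact K.
    apply: (@subclosed_compact _ _ `[0, M]%classic).
    - by apply: closedI => //; exact: itv_closed.
    - exact: segment_compact.
    - exact: subIsetr.
  pose g s : R := Num.max `|f s - Num.sqrt s| (f s - m).
  have cg : {within K, continuous g}.
    have cfK : {within K, continuous f}.
      by apply: (continuous_subspaceW _ cf); exact: subIsetl.
    have cs : {within K, continuous (@Num.sqrt R)}.
      by apply: continuous_subspaceT => s; exact: sqrt_continuous.
    have cn : {within K, continuous (fun s => `|f s - Num.sqrt s|)}.
      by move=> s; apply: cvg_norm; apply: cvgB; [exact: cfK|exact: cs].
    have cm : {within K, continuous (fun s => f s - m)}.
      by move=> s; apply: cvgB; [exact: cfK|exact: cvg_cst].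
    by move=> s; exact: (continuous_max (cn s) (cm s)).
  have [c Kc gc] := compact_EVT_min KN0 cK cg.
  exists (g c).
    have [Dc _] := set_mem Kc; rewrite /g lt_max.
    have [fc|fc] := eqVneq (f c) (Num.sqrt c).
      by rewrite subr_gt0 res// orbT.
    by rewrite normr_gt0 subr_eq0 fc.
  move=> s Ds sM; have : K s by split=> //=; rewrite in_itv/= sM ltW ?D0.
  by move=> /mem_set /gc; rewrite {2}/g le_max => /orP[|]; [left|right].
(* The second bound gives [(m + d) (1 - q) >= m], and [q f s <= d] when [f s < m + d]; the third
   gives [q sqrt s <= d] for [s <= M]. *)
pose q : R := Num.min 2^-1 (Num.min (d / (m + d)) (d / Num.sqrt M)).
have md0 : 0 < m + d by lra.
have sM0 : 0 < Num.sqrt M by rewrite sqrtr_gt0.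
have q0 : 0 < q by rewrite !lt_min !divr_gt0// invr_gt0 ltr0n.
have q12 : q <= 2^-1 by rewrite ge_min lexx.
have qd1 : q <= d / (m + d) by rewrite !ge_min lexx orbT.
have qd2 : q <= d / Num.sqrt M by rewrite !ge_min lexx !orbT.
have k1 : 1 - q <= Num.sqrt (1 - q ^+ 2).
  have q1 : 0 <= 1 - q by lra.
  have q2 : (1 - q) ^+ 2 <= 1 - q ^+ 2 by have := mulr_ge0 (ltW q0) q1; lra.
  have q3 : 0 <= 1 - q ^+ 2 by apply: le_trans q2; exact: sqr_ge0.
  by rewrite -(@ler_pXn2r _ 2) ?nnegrE ?sqrtr_ge0 ?sqr_sqrtr.
set k := Num.sqrt _ in k1; exists q; first by apply/andP; split=> //; lra.
move=> s Ds; rewrite -/k => kf ks.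
have s0 := D0 _ Ds; have fs0 := f0 _ Ds.
have sq0 : 0 < Num.sqrt s by rewrite sqrtr_gt0.
have [sM|sM] := leP s M; last first.
  have : 4 * m <= Num.sqrt s.
    rewrite -(@ler_pXn2r _ 2) ?nnegrE ?mulr_ge0 ?(ltW sq0)// sqr_sqrtr ?(ltW s0)//.
    by rewrite (le_trans _ (ltW sM))// /M lerDl.
  have : 2^-1 * Num.sqrt s <= k * Num.sqrt s by apply: ler_wpM2r; lra.
  have : f s * 2^-1 <= f s * (1 - q) by apply: ler_wpM2l; lra.
  lra.
have [fm|fm] := leP (m + d) (f s).
  apply: (@le_trans _ _ ((m + d) * (1 - q))); last by apply: ler_wpM2r; lra.
  by move: qd1; rewrite ler_pdivlMr//; lra.
exfalso; have [h|h] := hd _ Ds sM; last by lra.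
have sMs : Num.sqrt s <= Num.sqrt M by rewrite ler_wsqrtr.
have [fs|fs] := leP (f s) (Num.sqrt s).
  have : d <= Num.sqrt s - f s by move: h; rewrite ler0_norm; lra.
  have : q * Num.sqrt s <= d.
    apply: (@le_trans _ _ (q * Num.sqrt M)); first by apply: ler_wpM2l; lra.
    by rewrite -ler_pdivlMr.
  have : (1 - q) * Num.sqrt s <= k * Num.sqrt s by apply: ler_wpM2r; lra.
  lra.
have : d <= f s - Num.sqrt s by move: h; rewrite gtr0_norm; lra.
have : q * f s <= d.
  apply: (@le_trans _ _ (q * (m + d))); first by apply: ler_wpM2l; lra.
  by rewrite -ler_pdivlMr.
have : (1 - q) * f s <= k * f s by apply: ler_wpM2r; lra.
lra.
Qed.

End DecayRates.

(** * The energy space *)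

Section EnergySpace.
Context {R : realType} {H : hilbertType R} (A : operator H) (E : spectral_measure H).
Hypothesis AE : is_spectral_measure_of A E.
Hypothesis A_spectrum : forall s, spectrum A s -> 0 < s.
Local Notation borel g := (measurable_fun [set: measurableTypeR R] g).
Local Notation D := (spectrum A).
Local Notation X := (energy_space A E).
Local Notation N := (energy_norm A E).

Definition sqrt_spectrum : R -> R := (Num.sqrt \_ D)%R.
Local Notation w1 := sqrt_spectrum.
Let mD : measurable (D : set (measurableTypeR R)) := measurable_spectrum AE.

Lemma measurable_sqrt (B : set (measurableTypeR R)) : measurable B ->
  measurable_fun B (@Num.sqrt R).
Proof.
move=> mB; apply: measurable_funTS; apply: continuous_measurable_fun.
exact: sqrt_continuous.
Qed.

Lemma borel_sqrt_spectrum : borel w1.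
Proof. by apply/(measurable_restrictT _ mD); exact: measurable_sqrt. Qed.

Lemma op_sqrt_domE u : op_dom (op_sqrt A E) u <-> sqint E w1 u.
Proof. by apply: spectral_domE => //; exact: measurable_sqrt. Qed.

Lemma op_sqrtE u : op_dom (op_sqrt A E) u -> op_sqrt A E u = fcalc E w1 u.
Proof. by move=> du; apply: spectral_integralE => //; exact: measurable_sqrt. Qed.

Lemma fcalc_step_fun m x : fcalc E (step_fun m) x = step_op E m x.
Proof.
have := fcalc_dist m (measurable_step_fun m) (sqint_step_fun E m x).
under eq_Rintegral do rewrite subrr.
by rewrite Rintegral_sqr0 => /eqP; rewrite sqrf_eq0 normr_eq0 subr_eq0 => /eqP.
Qed.

Definition invsqrt_spectrum : R -> R := ((fun s => (Num.sqrt s)^-1) \_ D)%R.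
Local Notation w3 := invsqrt_spectrum.

Lemma borel_invsqrt_spectrum : borel w3.
Proof.
apply/(measurable_restrictT _ mD); apply: subspace_continuous_measurable_fun => //.
apply: continuous_in_subspaceT => s /set_mem Ds.
apply: cvgV; last exact: sqrt_continuous.
by rewrite gt_eqF// sqrtr_gt0 A_spectrum.
Qed.

(** The spectrum is closed and does not contain 0. This is what makes [A^{-1/2}] bounded. *)
Lemma spectrum_gap : exists2 d : R, 0 < d & forall s, D s -> d <= s.
Proof.
have : nbhs (0 : R) (~` D).
  apply: open_nbhs_nbhs; split; first exact: closed_openC (closed_spectrum AE).
  by move=> /A_spectrum; rewrite ltxx.
move=> /nbhs_ballP[d d0 dD]; exists d => // s Ds; rewrite leNgt; apply/negP => sd.
by apply: (dD s) => //; rewrite /ball/= sub0r normrN gtr0_norm// A_spectrum.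
Qed.

Lemma sqint_invsqrt p : sqint E w3 p.
Proof.
have [d d0 dD] := spectrum_gap.
rewrite -[p](sm_setT E); apply: (@sqint_bounded_on _ _ _ _ _ _ (Num.sqrt d)^-1) => //.
  exact: borel_invsqrt_spectrum.
move=> s _; rewrite /w3 patchE; case: ifPn => [/set_mem Ds|_].
  rewrite normfV ger0_norm ?sqrtr_ge0// lef_pV2 ?posrE ?sqrtr_gt0 ?d0 ?A_spectrum//.
  by rewrite ler_wsqrtr// dD.
by rewrite normr0 invr_ge0 sqrtr_ge0.
Qed.

Let one : seq (R * @mset R) := [:: (1, exist measurable (D : set (measurableTypeR R)) mD)].

Let one_op x : step_op E one x = x.
Proof. by rewrite /step_op big_seq1/= scale1r sm_spectrum. Qed.

Let w13 : (fun s => w1 s * w3 s) = step_fun one.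
Proof.
apply/funext => s; rewrite /step_fun big_seq1/= mul1r indicE /w1 /w3 !patchE.
have [Ds|_] := boolP (s \in D); last by rewrite mulr0.
by rewrite divff// gt_eqF// sqrtr_gt0 A_spectrum//; exact: set_mem.
Qed.

Let w31 : (fun s => w3 s * w1 s) = step_fun one.
Proof. by rewrite -w13; apply/funext => s; rewrite mulrC. Qed.

(** The product of the two multipliers is the indicator of the spectrum, which acts as the identity.
    Together with [sqrtK] this identifies the energy space with [H * H]. *)
Lemma invsqrtK p : sqint E w1 (fcalc E w3 p) /\ fcalc E w1 (fcalc E w3 p) = p.
Proof.
have [i ->] : sqint E w1 (fcalc E w3 p) /\
    fcalc E w1 (fcalc E w3 p) = fcalc E (fun s => w1 s * w3 s) p.
  apply: fcalcM; [exact: borel_sqrt_spectrum|exact: borel_invsqrt_spectrum|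
    exact: sqint_invsqrt|by rewrite w13; exact: sqint_step_fun].
by split=> //; rewrite w13 fcalc_step_fun one_op.
Qed.

Lemma sqrtK u : sqint E w1 u -> fcalc E w3 (fcalc E w1 u) = u.
Proof.
move=> iu; have [_ ->] : sqint E w3 (fcalc E w1 u) /\
    fcalc E w3 (fcalc E w1 u) = fcalc E (fun s => w3 s * w1 s) u.
  apply: fcalcM; [exact: borel_invsqrt_spectrum|exact: borel_sqrt_spectrum|
    by []|by rewrite w31; exact: sqint_step_fun].
by rewrite w31 fcalc_step_fun one_op.
Qed.

Lemma energy_space_lin (a : R) x y : X x -> X y -> X (a *: x + y).
Proof.
rewrite /energy_space/= => /op_sqrt_domE ix /op_sqrt_domE iy; apply/op_sqrt_domE.
exact: sqint_lin borel_sqrt_spectrum _ _.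
Qed.

Lemma energy_space0 : X 0.
Proof. by apply/op_sqrt_domE; exact: sqint0 borel_sqrt_spectrum. Qed.

Lemma energy_spaceB x y : X x -> X y -> X (x - y).
Proof.
by move=> Xx Xy; rewrite addrC -scaleN1r; exact: energy_space_lin.
Qed.

Lemma energy_spaceZ (a : R) x : X x -> X (a *: x).
Proof.
by move=> Xx; rewrite -[_ *: _]addr0; apply: energy_space_lin => //; exact: energy_space0.
Qed.

Lemma op_sqrt_lin (a : R) x y : X x -> X y ->
  op_sqrt A E (a *: x + y).1 = a *: op_sqrt A E x.1 + op_sqrt A E y.1.
Proof.
move=> Xx Xy; have Xxy := energy_space_lin a Xx Xy.
rewrite !op_sqrtE// fcalc_lin//; first exact: borel_sqrt_spectrum.
- exact/op_sqrt_domE.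
- exact/op_sqrt_domE.
Qed.

Lemma op_sqrtB x y : X x -> X y ->
  op_sqrt A E (x - y).1 = op_sqrt A E x.1 - op_sqrt A E y.1.
Proof.
move=> Xx Xy; have := op_sqrt_lin (-1) Xy Xx.
by rewrite !scaleN1r ![- _ + _]addrC.
Qed.

Lemma sqr_energy_norm x : N x ^+ 2 = `|op_sqrt A E x.1| ^+ 2 + `|x.2| ^+ 2.
Proof. by rewrite sqr_sqrtr// addr_ge0// sqr_ge0. Qed.

Lemma energy_norm_ge0 x : 0 <= N x. Proof. exact: sqrtr_ge0. Qed.

Lemma op_sqrt_le_energy x : `|op_sqrt A E x.1| <= N x.
Proof.
rewrite -(@ler_pXn2r _ 2) ?nnegrE ?energy_norm_ge0// sqr_energy_norm lerDl.
exact: sqr_ge0.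
Qed.

Lemma snd_le_energy x : `|x.2| <= N x.
Proof.
rewrite -(@ler_pXn2r _ 2) ?nnegrE ?energy_norm_ge0// sqr_energy_norm lerDr.
exact: sqr_ge0.
Qed.

Lemma energy_norm_le x : N x <= `|op_sqrt A E x.1| + `|x.2|.
Proof.
rewrite -(@ler_pXn2r _ 2) ?nnegrE ?energy_norm_ge0 ?addr_ge0// sqr_energy_norm.
have := mulr_ge0 (normr_ge0 (op_sqrt A E x.1)) (normr_ge0 x.2); lra.
Qed.

Lemma op_sqrt0 : op_sqrt A E 0 = 0.
Proof. by have := op_sqrtB energy_space0 energy_space0; rewrite !subrr. Qed.

Lemma energy_norm0 : N 0 = 0.
Proof.
have -> : N 0 = Num.sqrt (`|op_sqrt A E 0| ^+ 2 + `|0 : H| ^+ 2) by [].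
by rewrite op_sqrt0 !normr0 expr0n/= addr0 sqrtr0.
Qed.

Lemma energy_normZ (a : R) x : X x -> N (a *: x) = `|a| * N x.
Proof.
move=> Xx; have := op_sqrt_lin a Xx energy_space0.
rewrite (op_sqrt0 : op_sqrt A E (0 : H * H).1 = 0) !addr0 => aE; apply/eqP; rewrite -(@eqrXn2 _ 2)//;
  rewrite ?mulr_ge0 ?energy_norm_ge0// exprMn !sqr_energy_norm aE /=.
by rewrite !normrZ !exprMn mulrDr.
Qed.

(** * Boundedness of the semigroup near time 0 *)

Section LocalBound.
Variable S : R -> H * H -> H * H.
Hypothesis S_semigroup : C0_semigroup X N S.

(** Transports the energy norm to the normed module [H * H], where the uniform boundedness principle
    is available. The norm there is the maximum, hence the factor 2 in the comparison. *)
Let pair_energy (x : H * H) : H * H := (op_sqrt A E x.1, x.2).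

Let pair_energy_le x : `|pair_energy x| <= N x.
Proof. by rewrite prod_normE /= ge_max op_sqrt_le_energy snd_le_energy. Qed.

Let energy_le_pair x : N x <= 2 * `|pair_energy x|.
Proof.
apply: le_trans (energy_norm_le _) _.
have : `|op_sqrt A E x.1| <= `|pair_energy x| by rewrite prod_normE le_max lexx.
have : `|x.2| <= `|pair_energy x| by rewrite prod_normE le_max lexx orbT.
lra.
Qed.

Let pair_energy_lin (a : R) x y : X x -> X y ->
  pair_energy (a *: x + y) = a *: pair_energy x + pair_energy y.
Proof. by move=> Xx Xy; rewrite /pair_energy op_sqrt_lin. Qed.

(** Strong continuity at 0 makes the maps [S (h n) \o J] converge pointwise along [h n -> 0], hence
    pointwise bounded on the complete space [H]; Banach-Steinhaus makes the bound uniform. *)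
Let semigroup_embed_bound (J : H -> H * H) (h : nat -> R) :
  (forall (a : R) x y, J (a *: x + y) = a *: J x + J y) ->
  (forall z, X (J z)) -> (forall z, N (J z) <= `|z|) ->
  (forall n, 0 <= h n <= n.+1%:R^-1) ->
  exists2 M, 0 <= M & forall n z, N (S (h n) (J z)) <= M * `|z|.
Proof.
have [Sb S0 Sadd Sc] := S_semigroup.
move=> Jlin XJ NJ h0n.
have h0 n : 0 <= h n by have /andP[] := h0n n.
have hn n : h n <= n.+1%:R^-1 by have /andP[] := h0n n.
pose L n (z : H) : H * H := pair_energy (S (h n) (J z)).
have XS n z : X (S (h n) (J z)) by have [XS _ _] := Sb _ (h0 n); exact: XS.
have Llin n : linear (L n).
  move=> a x y; rewrite /L Jlin; have [_ Slin _] := Sb _ (h0 n).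
  by rewrite Slin// pair_energy_lin.
have [|z|M hM] := @Banach_Steinhauss R H (H * H)%type (range L) _ _ 1.
- move=> _ [n _ <-]; split=> // r; have [_ _ [K SK]] := Sb _ (h0 n).
  exists (`|K| * r) => x xr.
  apply: le_trans (pair_energy_le _) _; apply: le_trans (SK _ (XJ x)) _.
  apply: le_trans (ler_wpM2r (energy_norm_ge0 _) (ler_norm K)) _.
  by rewrite ler_wpM2l// (le_trans (NJ x)).
- have c : L n z @[n --> \oo] --> pair_energy (J z).
    apply/cvgrPdist_lt => e e0.
    have cz := Sc _ (XJ z).
    have : \forall t \near (0:R)^'+, `|N (S t (J z) - J z)| < e.
      exact: (cvgr0_norm_lt _ cz).
    move=> /near_right0[d d0 dP].
    have ch : \forall n \near \oo, `|0 - n.+1%:R^-1| < d.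
      by have /cvgrPdist_lt/(_ _ d0) := @cvg_harmonic R.
    apply: filterS ch => n /=; rewrite sub0r normrN ger0_norm// => nd.
    rewrite distrC; apply: (@le_lt_trans _ _ (N (S (h n) (J z) - J z))).
      apply: le_trans (pair_energy_le _).
      by rewrite /pair_energy (op_sqrtB (XS n z) (XJ z)).
    have := h0 n; rewrite le_eqVlt => /predU1P[<-|hn0].
      by rewrite S0// subrr energy_norm0.
    apply: le_lt_trans (ler_norm _) _; apply: dP.
    by rewrite hn0 (le_lt_trans (hn n)).
  have [B [_ hB]] := @cvg_seq_bounded _ R^o _ (cvgP _ (cvg_norm c)).
  exists (B + 1) => _ [n _ <-]; rewrite -[leLHS]normr_id.
  by apply: hB => //; rewrite ltrDl.
- have hM' n z : `|z| <= 1 -> `|L n z| <= M by apply: hM; exists n.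
  have M0 : 0 <= M by apply: le_trans (hM' 0%N 0 _); rewrite ?normr0.
  exists (2 * M) => [|n z]; first by rewrite mulr_ge0.
  apply: le_trans (energy_le_pair _) _; rewrite -mulrA ler_pM2l//.
  rewrite -/(L n z).
  have L0 : L n 0 = 0.
    by have := Llin n (-1) 0 0; rewrite scaler0 addr0 scaleN1r addNr.
  have [->|z0] := eqVneq z 0; first by rewrite L0 !normr0 mulr0.
  have nz : 0 < `|z| by rewrite normr_gt0.
  have -> : L n z = `|z| *: L n (`|z|^-1 *: z).
    have := Llin n (`|z|) (`|z|^-1 *: z) 0.
    by rewrite L0 !addr0 scalerA divff ?gt_eqF// scale1r.
  rewrite normrZ normr_id mulrC ler_pM2r//; apply: hM'.
  by rewrite normrZ normfV normr_id mulVf// gt_eqF.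
Qed.

(* [is_generator] only provides right derivatives of the orbits; this bound is
   what makes them left continuous.  The uniform boundedness principle is
   applied on [H], through the embeddings [p |-> (A^{-1/2} p, 0)] and
   [v |-> (0, v)] into the energy space. *)
Lemma semigroup_local_bound : exists M, exists2 d : R, 0 < d & forall h, 0 <= h <= d ->
  forall x, X x -> N (S h x) <= M * N x.
Proof.
have [Sb S0 Sadd Sc] := S_semigroup.
apply: contrapT => unb.
(* Without a local bound, the norms of [S] are unbounded along some sequence of times tending to
   0. *)
have ex n : exists h, 0 <= h <= n.+1%:R^-1 /\
    exists2 x, X x & n%:R * N x < N (S h x).
  apply: contrapT => nex; apply: unb; exists n%:R, n.+1%:R^-1 => //.
  move=> h h0n x Xx; rewrite leNgt; apply/negP => lt.
  by apply: nex; exists h; split=> //; exists x.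
have [h hP] := choice ex.
have h0n n : 0 <= h n <= n.+1%:R^-1 by have [] := hP n.
pose J1 (p : H) : H * H := (fcalc E w3 p, 0).
pose J2 (v : H) : H * H := (0, v).
have XJ1 p : X (J1 p) by apply/op_sqrt_domE; exact: (invsqrtK p).1.
have XJ2 v : X (J2 v) by exact: energy_space0.
have sqrtJ1 p : op_sqrt A E (J1 p).1 = p.
  by rewrite op_sqrtE ?(invsqrtK p).2//; exact: XJ1.
have [||p|M1 M10 hM1] := semigroup_embed_bound (J := J1) _ _ _ h0n.
- move=> a x y; rewrite /J1; congr (_, _); last by rewrite /= scaler0 addr0.
  exact: fcalc_lin borel_invsqrt_spectrum (sqint_invsqrt _) (sqint_invsqrt _).
- exact: XJ1.
- by apply: le_trans (energy_norm_le _) _; rewrite sqrtJ1 normr0 addr0.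
have [||v|M2 M20 hM2] := semigroup_embed_bound (J := J2) _ _ _ h0n.
- by move=> a x y; rewrite /J2; congr (_, _); rewrite /= scaler0 addr0.
- exact: XJ2.
- by apply: le_trans (energy_norm_le _) _; rewrite (op_sqrt0 : op_sqrt A E (J2 v).1 = 0) normr0 add0r.
pose K := 2 * (M1 + M2).
pose n := (Num.truncn K).+1.
have [_ [x Xx]] := hP n; apply/negP; rewrite -leNgt.
have Kn : K <= n%:R by exact/ltW/truncnS_gt.
have hn0 : 0 <= h n by have /andP[] := h0n n.
apply: (@le_trans _ _ (K * N x)); last by rewrite ler_wpM2r// energy_norm_ge0.
have xE : x = 1 *: J1 (op_sqrt A E x.1) + J2 x.2.
  rewrite scale1r /J1 /J2 op_sqrtE//.
  rewrite sqrtK; last exact/op_sqrt_domE.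
  by case: (x) => a b; congr (_, _); rewrite /= ?addr0 ?add0r.
have [XS Slin _] := Sb _ hn0.
have SE : S (h n) x = 1 *: S (h n) (J1 (op_sqrt A E x.1)) + S (h n) (J2 x.2).
  by rewrite {1}xE Slin.
apply: le_trans (energy_le_pair _) _; rewrite SE pair_energy_lin//; [|exact: XS..].
rewrite scale1r /K -mulrA ler_pM2l//; apply: le_trans (ler_normD _ _) _.
rewrite mulrDl; apply: lerD.
- apply: le_trans (pair_energy_le _) _; apply: le_trans (hM1 _ _) _.
  by rewrite ler_wpM2l// op_sqrt_le_energy.
- apply: le_trans (pair_energy_le _) _; apply: le_trans (hM2 _ _) _.
  by rewrite ler_wpM2l// snd_le_energy.
Qed.

End LocalBound.

End EnergySpace.

(** * The damped wave equation *)

Section WaveDynamics.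
Context {R : realType} {H : hilbertType R} (A : operator H) (E : spectral_measure H).
Hypothesis AE : is_spectral_measure_of A E.
Hypothesis A_spectrum : forall s, spectrum A s -> 0 < s.
Variable f : R -> R.
Hypothesis f_positive : forall s, spectrum A s -> 0 < f s.
Hypothesis f_continuous : {within spectrum A, continuous f}.
Hypothesis f_le : exists c, forall s, spectrum A s -> f s <= c * s.
Local Notation borel g := (measurable_fun [set: measurableTypeR R] g).
Local Notation D := (spectrum A).
Local Notation X := (energy_space A E).
Local Notation N := (energy_norm A E).
Local Notation w1 := (sqrt_spectrum A).
Local Notation T := (op_sqrt A E).
Local Notation W := (wave_operator A E f).
Let mD : measurable (D : set (measurableTypeR R)) := measurable_spectrum AE.

Definition damping_spectrum : R -> R := ((fun s => f s / Num.sqrt s) \_ D)%R.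
Local Notation w2 := damping_spectrum.

Lemma measurable_damping :
  measurable_fun (D : set (measurableTypeR R)) (fun s => f s / Num.sqrt s).
Proof.
apply: measurable_funM.
  exact: subspace_continuous_measurable_fun.
apply: subspace_continuous_measurable_fun => //.
apply: continuous_in_subspaceT => s /set_mem Ds.
apply: cvgV; last exact: sqrt_continuous.
by rewrite gt_eqF// sqrtr_gt0 A_spectrum.
Qed.

Lemma borel_damping_spectrum : borel w2.
Proof. by apply/(measurable_restrictT _ mD); exact: measurable_damping. Qed.

Lemma sqint_damping v : sqint E w1 v -> sqint E w2 v.
Proof.
have [c fc] := f_le; move=> iv.
apply: (@le_sqint _ _ _ _ (fun s => c * w1 s)); last exact: sqintZ.
  exact: borel_damping_spectrum.
move=> s; rewrite /w2 /w1 /damping_spectrum /sqrt_spectrum !patchE.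
case: ifPn => [/set_mem Ds|_]; last by rewrite mulr0.
have s0 := A_spectrum Ds; have q0 : 0 < Num.sqrt s by rewrite sqrtr_gt0.
rewrite ger0_norm ?divr_ge0 ?(ltW (f_positive Ds)) ?(ltW q0)//.
apply: le_trans (ler_norm _); rewrite ler_pdivrMr// -mulrA -expr2 sqr_sqrtr ?fc//.
exact: ltW.
Qed.

Lemma op_funE v : sqint E w2 v ->
  op_fun A E (fun s => f s / Num.sqrt s) v = fcalc E w2 v.
Proof.
move=> iv; apply: spectral_integralE => //; first exact: measurable_damping.
by apply/spectral_domE => //; exact: measurable_damping.
Qed.

(** Near [s0] the multipliers [sqrt s] and [f s / sqrt s] are almost constant. The damping has to be
    frozen inside [wave_arg], before the outer square root is applied, because [f(A) v] alone may be
    undefined. *)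
Lemma wave_cell (s0 e0 : R) : D s0 -> 0 < e0 ->
  exists2 d : R, 0 < d & forall B : set (measurableTypeR R), measurable B ->
    B `<=` D -> B `<=` ball s0 d -> forall y, op_dom W y ->
    let P := E B (T y.1) in let V := E B y.2 in
    `|E B (T (W y).1) - Num.sqrt s0 *: V| <= e0 * (`|P| + `|V|) /\
    `|E B (W y).2 - (- (Num.sqrt s0 *: P) - (2 * f s0) *: V)| <=
      e0 * (`|P| + `|V|).
Proof.
move=> Ds0 e00; set sg := Num.sqrt s0; set g := f s0 / sg.
have sg0 : 0 < sg by rewrite sqrtr_gt0 A_spectrum.
have g0 : 0 < g by rewrite divr_gt0// f_positive.
(* Collects the errors of the nested multipliers; the requirement [e <= 1] below bounds [e + g] by
   [1 + g]. *)
pose K := 3 + 2 * g + 2 * sg.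
have K0 : 0 < K by rewrite /K; lra.
pose e := Num.min 1 (e0 / K).
have e1 : e <= 1 by rewrite ge_min lexx.
have eK : e * K <= e0 by rewrite -ler_pdivlMr// ge_min lexx orbT.
have e0' : 0 < e by rewrite lt_min ltr01 divr_gt0.
have cs : Num.sqrt s @[s --> within D (nbhs s0)] --> sg.
  by apply: cvg_within_filter; exact: sqrt_continuous.
have cf : f s @[s --> within D (nbhs s0)] --> f s0.
  by have /subspace_continuousP := f_continuous; apply.
have cg : f s / Num.sqrt s @[s --> within D (nbhs s0)] --> g.
  by apply: cvgM => //; apply: cvgV => //; rewrite gt_eqF.
have nears : \forall s \near within D (nbhs s0), `|sg - Num.sqrt s| < e.
  by have /cvgrPdist_lt := cs; apply.
have nearg : \forall s \near within D (nbhs s0), `|g - f s / Num.sqrt s| < e.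
  by have /cvgrPdist_lt := cg; apply.
have /nbhs_ballP[d d0 dP] : nbhs s0 [set s | D s ->
    `|sg - Num.sqrt s| < e /\ `|g - f s / Num.sqrt s| < e].
  exact: (filterI nears nearg).
exists d => // B mB BD Bd y [dy1 dy2 dy3] P V.
have iy1 : sqint E w1 y.1 by exact/op_sqrt_domE.
have iy2 : sqint E w1 y.2 by exact/op_sqrt_domE.
have iy3 : sqint E w1 (wave_arg A E f y) by exact/op_sqrt_domE.
have iv2 : sqint E w2 y.2 by exact: sqint_damping.
have Bw1 s : B s -> `|w1 s - sg| <= e.
  move=> Bs; rewrite /sqrt_spectrum patchE mem_set; last exact: BD.
  by rewrite distrC ltW//; have [] := dP s (Bd _ Bs) (BD _ Bs).
have Bw2 s : B s -> `|w2 s - g| <= e.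
  move=> Bs; rewrite /damping_spectrum patchE mem_set; last exact: BD.
  by rewrite distrC ltW//; have [] := dP s (Bd _ Bs) (BD _ Bs).
have bw1 := borel_sqrt_spectrum AE; have bw2 := borel_damping_spectrum.
have hP : `|E B (T y.2) - sg *: V| <= e * `|V|.
  rewrite (op_sqrtE AE dy2) -fcalc_sm//; apply: fcalc_near => //; exact: ltW.
have hG : `|E B (fcalc E w2 y.2) - g *: V| <= e * `|V|.
  rewrite -fcalc_sm//; apply: fcalc_near => //; exact: ltW.
set G := E B (fcalc E w2 y.2) in hG.
have Y : E B (wave_arg A E f y) = P + 2 *: G.
  by rewrite /wave_arg op_funE// linearD linearZ.
have hY : `|E B (T (wave_arg A E f y)) - sg *: (P + 2 *: G)| <= e * `|P + 2 *: G|.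
  rewrite (op_sqrtE AE dy3) -fcalc_sm// Y -[P + _]Y; apply: fcalc_near => //; exact: ltW.
have P0 := normr_ge0 P; have V0 := normr_ge0 V.
split.
  apply: le_trans hP _.
  have : e <= e * K by rewrite ler_peMr ?(ltW e0')// /K; lra.
  nra.
have -> : E B (W y).2 - (- (sg *: P) - (2 * f s0) *: V) =
   - (E B (T (wave_arg A E f y)) - sg *: (P + 2 *: G)) - (2 * sg) *: (G - g *: V).
  rewrite /= linearN /=.
  have -> : (2 * f s0) *: V = (2 * sg) *: (g *: V).
    by rewrite scalerA; congr (_ *: _); rewrite /g; field; rewrite gt_eqF.
  have -> : sg *: (P + 2 *: G) = sg *: P + (2 * sg) *: G.
    by rewrite scalerDr scalerA mulrC.
  rewrite scalerBr !opprD !opprK.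
  set a := E B _; set b := sg *: P; set c := (2 * sg) *: G; set k := (2 * sg) *: (g *: V).
  by rewrite -!addrA; congr (_ + (_ + _)); rewrite addrA subrr add0r.
apply: le_trans (ler_normB _ _) _; rewrite normrN normrZ.
have GV : `|G| <= (e + g) * `|V|.
  rewrite -(subrK (g *: V) G) (le_trans (ler_normD _ _))// mulrDl lerD//.
  by rewrite normrZ gtr0_norm.
have YG : `|P + 2 *: G| <= `|P| + 2 * `|G|.
  by apply: le_trans (ler_normD _ _) _; rewrite normrZ ger0_norm.
rewrite (ger0_norm (x := 2 * sg)); last by rewrite mulr_ge0// ltW.
have h1 : `|P + 2 *: G| <= `|P| + 2 * (1 + g) * `|V|.
  have : (e + g) * `|V| <= (1 + g) * `|V| by rewrite ler_wpM2r// lerD2r.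
  lra.
have h2 : 2 * sg * `|G - g *: V| <= e * (2 * sg * `|V|).
  by rewrite [leRHS]mulrCA ler_pM2l// mulr_gt0.
have h3 : e * `|P + 2 *: G| <= e * (`|P| + 2 * (1 + g) * `|V|) by rewrite ler_pM2l.
apply: (@le_trans _ _ (e * K * (`|P| + `|V|))); last first.
  by rewrite ler_wpM2r// addr_ge0.
apply: (@le_trans _ _ (e * (`|P| + 2 * (1 + g) * `|V| + 2 * sg * `|V|))).
  rewrite mulrDr; apply: lerD h2; exact: le_trans hY h3.
rewrite -[leRHS]mulrA ler_pM2l// /K; have := mulr_ge0 (ltW g0) P0; have := mulr_ge0 (ltW sg0) P0; lra.
Qed.

End WaveDynamics.

(** * Orbits of the semigroup and decay on a spectral cell *)

Section WaveDecay.
Context {R : realType} {H : hilbertType R} (A : operator H) (E : spectral_measure H).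
Hypothesis AE : is_spectral_measure_of A E.
Hypothesis A_spectrum : forall s, spectrum A s -> 0 < s.
Variable f : R -> R.
Hypothesis f_positive : forall s, spectrum A s -> 0 < f s.
Hypothesis f_continuous : {within spectrum A, continuous f}.
Hypothesis f_le : exists c, forall s, spectrum A s -> f s <= c * s.
Local Notation D := (spectrum A).
Local Notation X := (energy_space A E).
Local Notation N := (energy_norm A E).
Local Notation T := (op_sqrt A E).
Local Notation W := (wave_operator A E f).
Local Notation mu := (scalar_measure E).
Variable S : R -> H * H -> H * H.
Hypothesis S_semigroup : C0_semigroup X N S.
Hypothesis S_generator : is_generator X N W S.

Lemma cvg0_le (u w : R -> R) (C : R) : (forall h, 0 <= u h) ->
  (\forall h \near (0:R)^'+, u h <= C * w h) ->
  w h @[h --> (0:R)^'+] --> (0:R) -> u h @[h --> (0:R)^'+] --> (0:R).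
Proof.
move=> u0 uw w0; apply: (@squeeze_cvgr _ _ _ _ (fun=> 0) (fun h => C * w h)).
- by near=> h; rewrite u0/=; near: h.
- exact: cvg_cst.
- have c : C * w h @[h --> (0:R)^'+] --> C * 0 by exact: cvgMr.
  by rewrite mulr0 in c.
Unshelve. all: by end_near. Qed.

Lemma cvg_norm_le (V : normedModType R) (u : R -> V) (l : V) (w : R -> R) (C : R) :
  (\forall h \near (0:R)^'+, `|u h - l| <= C * w h) ->
  w h @[h --> (0:R)^'+] --> (0:R) -> u h @[h --> (0:R)^'+] --> l.
Proof.
move=> uw w0; apply/cvgrPdist_lt => e e0.
have c : (fun h => `|u h - l|) @ (0:R)^'+ --> (0:R) by exact: cvg0_le uw w0.
have : \forall h \near (0:R)^'+, `|(`|u h - l|)| < e by exact: (cvgr0_norm_lt _ c).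
by apply: filterS => h; rewrite normr_id (distrC l).
Qed.

Lemma semigroup_space t x : 0 <= t -> X x -> X (S t x).
Proof.
move=> t0 Xx; have [Sb _ _ _] := S_semigroup; have [XS _ _] := Sb t t0.
exact: XS.
Qed.

(** The difference quotient at [S t x] is the image under the bounded operator [S t] of the one at
    [x]. *)
Lemma orbit_domain t x : 0 <= t -> op_dom W x ->
  op_dom W (S t x) /\ W (S t x) = S t (W x).
Proof.
have [Sb S0 Sadd Sc] := S_semigroup.
move=> t0 dx; apply/S_generator.
have [Xx XW c] := (S_generator x (W x)).2 (conj dx erefl).
have [XS Slin [K SK]] := Sb t t0.
split; [exact: XS|exact: XS|].
apply: (cvg0_le _ _ c (C := K)) => [h|]; first exact: energy_norm_ge0.
near=> h; have h0 : 0 < h by near: h; exact: nbhs_right_gt.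
have h0' := ltW h0.
have XSh : X (S h x) by exact: semigroup_space.
have Xd : X (S h x - x) by exact: energy_spaceB.
have Xq : X (h^-1 *: (S h x - x)) by exact: energy_spaceZ.
have SB a b : X a -> X b -> S t (a - b) = S t a - S t b.
  by move=> Xa Xb; have := Slin (-1) b a Xb Xa; rewrite !scaleN1r ![- _ + _]addrC.
have S00 : S t 0 = 0 by have := SB x x Xx Xx; rewrite !subrr.
have SZ a b : X b -> S t (a *: b) = a *: S t b.
  move=> Xb; have := Slin a b 0 Xb (energy_space0 AE).
  by rewrite S00 !addr0.
rewrite -Sadd// (addrC h) Sadd// -SB// -SZ// -SB//.
by apply: SK; exact: energy_spaceB.
Unshelve. all: by end_near. Qed.

Lemma orbit_rderiv t x : 0 <= t -> op_dom W x ->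
  rderiv (fun t => T (S t x).1) t (T (W (S t x)).1) /\
  rderiv (fun t => (S t x).2) t (W (S t x)).2.
Proof.
have [Sb S0 Sadd Sc] := S_semigroup.
move=> t0 dx; have [dS WS] := orbit_domain t0 dx.
have [Xx _ _] := (S_generator x (W x)).2 (conj dx erefl).
have [XS XWS c] := (S_generator (S t x) (W (S t x))).2 (conj dS erefl).
have XSh h : 0 < h -> X (S h (S t x)) by move=> h0; exact: semigroup_space (ltW h0) XS.
split; apply: (cvg_norm_le (C := 1) _ c); near=> h;
  have h0 : 0 < h by [near: h; exact: nbhs_right_gt];
  rewrite mul1r (addrC t) Sadd ?(ltW h0)//.
- have Xd : X (S h (S t x) - S t x) by apply: (energy_spaceB AE) => //; exact: XSh.
  apply: le_trans (op_sqrt_le_energy _ _ _).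
  rewrite (op_sqrtB AE)//; last exact: (energy_spaceZ AE).
  have := op_sqrt_lin AE h^-1 Xd (energy_space0 AE).
  rewrite addr0 => ->.
  rewrite (op_sqrt0 AE : T (0 : H * H).1 = 0) addr0 (op_sqrtB AE)//; exact: XSh.
- exact: le_trans (snd_le_energy _ _ _).
Unshelve. all: by end_near. Qed.

(** With [z = S (t - r) x], the increment is [- S (r - h) (S h z - z)]. The times [r - h] stay in
    the range of the local bound, so right continuity at [z] suffices. *)
Lemma orbit_left_continuous t x : 0 < t -> X x ->
  (T (S (t - h) x).1 @[h --> (0:R)^'+] --> T (S t x).1) /\
  ((S (t - h) x).2 @[h --> (0:R)^'+] --> (S t x).2).
Proof.
have [Sb S0 Sadd Sc] := S_semigroup.
move=> t0 Xx; have [M [d d0 SM]] := semigroup_local_bound AE A_spectrum S_semigroup.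
pose r := Num.min d t.
have r0 : 0 < r by rewrite lt_min d0.
have rd : r <= d by rewrite ge_min lexx.
have rt : r <= t by rewrite ge_min lexx orbT.
have tr : 0 <= t - r by rewrite subr_ge0.
pose z := S (t - r) x.
have Xz : X z by exact: semigroup_space.
have key : \forall h \near (0:R)^'+,
    X (S (t - h) x) /\ N (S (t - h) x - S t x) <= M * N (S h z - z).
  near=> h; have h0 : 0 < h by near: h; exact: nbhs_right_gt.
  have hr : h < r by near: h; exact: nbhs_right_lt.
  have hr0 : 0 <= r - h by rewrite subr_ge0 ltW.
  have XSh : X (S h z) by exact: semigroup_space (ltW h0) _.
  split; first by apply: semigroup_space => //; lra.
  have [_ Slin _] := Sb _ hr0.
  have -> : S (t - h) x = S (r - h) z.
    by rewrite /z -Sadd//; congr (S _ _); ring.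
  have -> : S t x = S (r - h) (S h z).
    rewrite /z -[S h _]Sadd ?(ltW h0)// -Sadd//; first by congr (S _ _); ring.
    by rewrite addr_ge0// ltW.
  have Xd : X (S h z - z) by exact: energy_spaceB.
  have -> : S (r - h) z - S (r - h) (S h z) = (-1) *: S (r - h) (S h z - z).
    have := Slin (-1) z (S h z) Xz XSh.
    by rewrite !scaleN1r ![- _ + _]addrC => ->; rewrite opprB.
  rewrite energy_normZ//; last exact: semigroup_space.
  by rewrite normrN1 mul1r; apply: SM => //; apply/andP; split; lra.
split; apply: (cvg_norm_le (C := M) _ (Sc _ Xz)); apply: filterS key => h [Xh hN];
  apply: le_trans hN.
- apply: le_trans (op_sqrt_le_energy _ _ _).
  by rewrite (op_sqrtB AE)//; exact: semigroup_space (ltW t0) _.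
- exact: (snd_le_energy A E (S (t - h) x - S t x)).
Unshelve. all: by end_near. Qed.

Lemma wave_local_decay x q r s0 e t : op_dom W x -> 0 <= t -> D s0 ->
  0 < q <= 1 -> rate_ok (Num.sqrt s0) (f s0) q r -> 0 < e ->
  exists2 d : R, 0 < d & forall B : set (measurableTypeR R), measurable B ->
    B `<=` D -> B `<=` ball s0 d ->
    `|E B (T (S t x).1)| ^+ 2 + `|E B (S t x).2| ^+ 2 <=
    4 / q ^+ 2 * expR ((- (2 * r) + e) * t) *
      (`|E B (T x.1)| ^+ 2 + `|E B x.2| ^+ 2).
Proof.
have [Sb S0 Sadd Sc] := S_semigroup.
move=> dx t0 Ds0 /andP[q0 q1] [k [k0 kq rf kr]] e0.
have [Xx _ _] := (S_generator x (W x)).2 (conj dx erefl).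
have q20 : 0 < q ^+ 2 by rewrite exprn_gt0.
have k1 : k < 1.
  by rewrite -(@ltr_pXn2r _ 2) ?nnegrE// expr1n; lra.
(* The freezing error costs 8 times the energy, and the energy is at most [lyap k / (1 - k)]; with
   this choice the rate loses exactly [e]. *)
pose e1 := e * (1 - k) / 8.
have e10 : 0 < e1 by rewrite /e1 divr_gt0// mulr_gt0// subr_gt0.
have [d d0 cell] := wave_cell AE A_spectrum f_positive f_continuous f_le Ds0 e10.
exists d => // B mB BD Bd.
pose P u := E B (T (S u x).1); pose V u := E B (S u x).2.
pose P1 u := E B (T (W (S u x)).1); pose V1 u := E B (W (S u x)).2.
have rderivE u y (F : R -> H) : rderiv F u y -> rderiv (fun u => E B (F u)) u (E B y).
  rewrite /rderiv => Fy.
  have -> : (fun h => h^-1 *: (E B (F (u + h)) - E B (F u))) =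
            (fun h => E B (h^-1 *: (F (u + h) - F u))).
    by apply/funext => h; rewrite linearZ /= (linearB (E B)).
  exact: cvg_sm.
have PP1 u : 0 <= u -> rderiv P u (P1 u).
  by move=> u0; apply: rderivE; exact: (orbit_rderiv u0 dx).1.
have VV1 u : 0 <= u -> rderiv V u (V1 u).
  by move=> u0; apply: rderivE; exact: (orbit_rderiv u0 dx).2.
pose Q u : R^o := inner (P u) (P u) + inner (V u) (V u) + (2 * k) * inner (P u) (V u).
have QE u : Q u = lyap k (P u) (V u) by rewrite /Q -!sqr_norm_inner.
pose Q1 u : R := inner (P1 u) (P u) + inner (P u) (P1 u) +
  (inner (V1 u) (V u) + inner (V u) (V1 u)) +
  (0 * inner (P u) (V u) + (2 * k) * (inner (P1 u) (V u) + inner (P u) (V1 u))).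
have Q1E u : Q1 u = lyap' k (P u) (V u) (P1 u) (V1 u).
  by rewrite /Q1 /lyap' (innerC (P1 u) (P u)) (innerC (V1 u) (V u)); ring.
have QQ1 u : 0 <= u -> rderiv Q u (Q1 u).
  move=> u0; apply: rderivD.
    by apply: rderivD; apply: rderiv_inner; [exact: PP1..|exact: VV1|exact: VV1].
  apply: (rderivM (u := fun=> 2 * k)).
    by rewrite /rderiv; under eq_fun do rewrite subrr scaler0; exact: cvg_cst.
  by apply: rderiv_inner; [exact: PP1|exact: VV1].
have dS u : 0 <= u -> op_dom W (S u x) by move=> u0; have [] := orbit_domain u0 dx.
have Q1le u : 0 <= u -> Q1 u <= (- (2 * r) + e) * Q u.
  move=> u0; rewrite Q1E QE.
  have [hP hV] := cell B mB BD Bd _ (dS u u0).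
  have := lyap'_perturbation (k := k) _ hP hV; rewrite k0 (ltW k1) => /(_ isT) h1.
  apply: le_trans h1 _.
  have h2 := @lyap'_oscillator _ _ k (Num.sqrt s0) (f s0) r (P u) (V u) k0 rf kr.
  have h3 := lyap_ge (P u) (V u) k0.
  have h4 : 8 * e1 * (`|P u| ^+ 2 + `|V u| ^+ 2) <= e * lyap k (P u) (V u).
    have -> : 8 * e1 * (`|P u| ^+ 2 + `|V u| ^+ 2) =
        e * ((1 - k) * (`|P u| ^+ 2 + `|V u| ^+ 2)) by rewrite /e1; field.
    by rewrite ler_pM2l.
  rewrite [leRHS]mulrDl; exact: lerD h2 h4.
have Qleft u : 0 < u -> Q (u - h) @[h --> (0:R)^'+] --> Q u.
  move=> u0; have [cP cV] := orbit_left_continuous u0 Xx.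
  have cP' : P (u - h) @[h --> (0:R)^'+] --> P u by exact: cvg_sm.
  have cV' : V (u - h) @[h --> (0:R)^'+] --> V u by exact: cvg_sm.
  apply: cvgD; first by apply: cvgD; exact: cvg_inner.
  by apply: cvgMr; exact: cvg_inner.
have := rderiv_gronwall t0 QQ1 Q1le Qleft; rewrite !QE => hQ.
have PV0 : P 0 = E B (T x.1) /\ V 0 = E B x.2 by rewrite /P /V S0.
rewrite -PV0.1 -PV0.2 -/(P t) -/(V t).
have l1 := lyap_ge (P t) (V t) k0; have l2 := lyap_le (P 0) (V 0) k0.
set a := `|P t| ^+ 2 + _ in l1 *; set b := `|P 0| ^+ 2 + _ in l2 *.
set ex := expR _ in hQ *.
have ex0 : 0 < ex by exact: expR_gt0.
have b0 : 0 <= b by rewrite addr_ge0// sqr_ge0.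
have h1 : (1 - k) * a <= (1 + k) * (ex * b).
  apply: (le_trans l1); apply: (le_trans hQ).
  by rewrite mulrCA ler_pM2l.
(* Origin of [4 / q^2]: [(1 + k) q^2 <= (1 + k) (1 - k^2) = (1 - k) (1 + k)^2]. *)
have h2 : q ^+ 2 * (1 + k) <= 4 * (1 - k).
  have h3 : (1 + k) * q ^+ 2 <= (1 + k) * (1 - k ^+ 2) by rewrite ler_pM2l; lra.
  have h4 : (1 + k) * (1 - k ^+ 2) = (1 - k) * (1 + k) ^+ 2 by ring.
  have h5 : (1 - k) * (1 + k) ^+ 2 <= (1 - k) * 4.
    rewrite ler_pM2l ?subr_gt0//; nra.
  lra.
have k10 : 0 < 1 - k by rewrite subr_gt0.
rewrite -(ler_pM2l (mulr_gt0 q20 k10)).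
have -> : q ^+ 2 * (1 - k) * (4 / q ^+ 2 * ex * b) = 4 * (1 - k) * (ex * b).
  by field; rewrite gt_eqF.
rewrite -mulrA; apply: (@le_trans _ _ (q ^+ 2 * ((1 + k) * (ex * b)))).
  by rewrite ler_pM2l.
by rewrite [leLHS]mulrA ler_wpM2r// mulr_ge0// ltW.
Qed.

End WaveDecay.

(** * From cells to the whole energy space *)

Section UniformDecay.
Context {R : realType} {H : hilbertType R} (A : operator H) (E : spectral_measure H).
Hypothesis AE : is_spectral_measure_of A E.
Hypothesis A_spectrum : forall s, spectrum A s -> 0 < s.
Variable f : R -> R.
Hypothesis f_positive : forall s, spectrum A s -> 0 < f s.
Hypothesis f_continuous : {within spectrum A, continuous f}.
Hypothesis f_le : exists c, forall s, spectrum A s -> f s <= c * s.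
Local Notation D := (spectrum A).
Local Notation X := (energy_space A E).
Local Notation N := (energy_norm A E).
Local Notation T := (op_sqrt A E).
Local Notation W := (wave_operator A E f).
Local Notation mu := (scalar_measure E).
Variable S : R -> H * H -> H * H.
Hypothesis S_semigroup : C0_semigroup X N S.
Hypothesis S_generator : is_generator X N W S.
Local Notation rates q r := (forall s, D s -> rate_ok (Num.sqrt s) (f s) q r).

Lemma wave_decay_eps x q r e t : op_dom W x -> 0 <= t -> 0 < q <= 1 ->
  rates q r -> 0 < e ->
  N (S t x) ^+ 2 <= 4 / q ^+ 2 * expR ((- (2 * r) + e) * t) * N x ^+ 2.
Proof.
move=> dx t0 q01 rs e0; set K := 4 / q ^+ 2 * _.
have K0 : 0 <= K by rewrite mulr_ge0 ?expR_ge0// divr_ge0// sqr_ge0.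
pose m1 := measure_add (mu (T (S t x).1)) (mu (S t x).2).
pose m2 := measure_add (mu (T x.1)) (mu x.2).
have mD : measurable (D : set (measurableTypeR R)) := measurable_spectrum AE.
have m1E B : m1 B = (`|E B (T (S t x).1)| ^+ 2 + `|E B (S t x).2| ^+ 2)%:E.
  by rewrite /m1 measure_addE EFinD.
have m2E B : m2 B = (`|E B (T x.1)| ^+ 2 + `|E B x.2| ^+ 2)%:E.
  by rewrite /m2 measure_addE EFinD.
have : (m1 D <= K%:E * m2 D)%E.
  apply: (measure_le_local (mu := m1) (nu := m2)) => // s0 Ds0.
  have [d d0 hd] := wave_local_decay AE A_spectrum f_positive f_continuous f_le
    S_semigroup S_generator dx t0 Ds0 q01 (rs _ Ds0) e0.
  exists d => // B mB BD Bd.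
  by have := hd B mB BD Bd; rewrite -lee_fin EFinM -m1E -m2E.
(* The projection on the whole spectrum is the identity, so the two measures of [D] are the
   energies. *)
by rewrite m1E m2E -EFinM lee_fin !sm_spectrum// -!sqr_energy_norm.
Qed.

Lemma wave_decay_dom x q r t : op_dom W x -> 0 <= t -> 0 < q <= 1 ->
  rates q r -> N (S t x) ^+ 2 <= (2 / q * expR (- r * t)) ^+ 2 * N x ^+ 2.
Proof.
move=> dx t0 q01 rs.
have c : 4 / q ^+ 2 * expR ((- (2 * r) + e) * t) * N x ^+ 2 @[e --> (0:R)^'+] -->
         4 / q ^+ 2 * expR ((- (2 * r) + 0) * t) * N x ^+ 2.
  apply: cvgMl; apply: cvgMr.
  have cc : (- (2 * r) + e) * t @[e --> (0:R)^'+] --> (- (2 * r) + 0) * t.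
    by apply: cvgMl; apply: cvgD; [exact: cvg_cst|exact: cvg_right_id].
  exact: (cvg_comp _ _ cc (@continuous_expR R _)).
have -> : (2 / q * expR (- r * t)) ^+ 2 = 4 / q ^+ 2 * expR ((- (2 * r) + 0) * t).
  rewrite exprMn expr_div_n -expRM_natl; congr (_ / _ * expR _); first by ring.
  by rewrite -mulr_natl; ring.
apply: (cvgr_to_ge c); near=> e; apply: wave_decay_eps => //.
Unshelve. all: by end_near. Qed.

(** Projecting onto the spectral set where both multipliers are at most [n] makes every domain
    condition automatic, and these sets increase to the whole line. *)
Lemma wave_truncation x : X x -> exists2 y : nat -> H * H,
  forall n, op_dom W (y n) &
  (T (y n).1 @[n --> \oo] --> T x.1) /\ ((y n).2 @[n --> \oo] --> x.2).
Proof.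
move=> Xx.
have bw1 := borel_sqrt_spectrum AE.
have bw2 := borel_damping_spectrum AE A_spectrum f_continuous.
set w1 := sqrt_spectrum A in bw1; set w2 := damping_spectrum A f in bw2.
pose C n : set (measurableTypeR R) :=
  [set s | `|w1 s| <= n%:R] `&` [set s | `|w2 s| <= n%:R].
have mC n : measurable (C n).
  by apply: measurableI; exact: measurable_bounded_level.
have iw1 n z : sqint E w1 (E (C n) z).
  by apply: (@sqint_bounded_on _ _ _ _ _ _ n%:R) => // s [].
have iw2 n z : sqint E w2 (E (C n) z).
  by apply: (@sqint_bounded_on _ _ _ _ _ _ n%:R) => // s [].
have cC z : E (C n) z @[n --> \oo] --> z.
  apply: cvg_sm_bigcup => //.
  - move=> m n mn; apply/subsetPset => s [/= h1 h2].
    by split; [apply: le_trans h1 _|apply: le_trans h2 _]; rewrite ler_nat.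
  - apply/seteqP; split=> // s _.
    exists (Num.truncn (Num.max `|w1 s| `|w2 s|)).+1 => //; split => /=;
      rewrite (@le_trans _ _ (Num.max `|w1 s| `|w2 s|)) ?le_max ?lexx ?orbT//;
      exact/ltW/truncnS_gt.
have ix1 : sqint E w1 x.1 by exact/op_sqrt_domE.
have sq n z : op_dom T (E (C n) z) by exact/op_sqrt_domE.
exists (fun n => (E (C n) x.1, E (C n) x.2)) => [n|].
  split; [exact: sq|exact: sq|apply/(op_sqrt_domE AE)].
  have -> : wave_arg A E f (E (C n) x.1, E (C n) x.2) =
      E (C n) (fcalc E w1 x.1 + 2 *: fcalc E w2 (E (C n) x.2)).
    rewrite /wave_arg (op_sqrtE AE (sq n x.1)).
    rewrite (op_funE AE A_spectrum f_continuous (iw2 n x.2)).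
    rewrite (fcalc_sm bw1 (mC n) ix1) (linearD (E (C n))) linearZ /=.
    by rewrite -(fcalc_sm bw2 (mC n) (iw2 n x.2)) (sm_idem E (mC n)).
  exact: iw1.
split; last exact: cC.
suff : T (E (C n) x.1) @[n --> \oo] --> T x.1 by [].
rewrite (op_sqrtE AE Xx).
have -> : (fun n => T (E (C n) x.1)) = (fun n => E (C n) (fcalc E w1 x.1)).
  by apply/funext => n; rewrite (op_sqrtE AE (sq n x.1)) fcalc_sm.
exact: cC.
Qed.

Lemma wave_decay x q r t : X x -> 0 <= t -> 0 < q <= 1 ->
  rates q r -> N (S t x) <= 2 / q * expR (- r * t) * N x.
Proof.
move=> Xx t0 q01 rs; have [Sb S0 Sadd Sc] := S_semigroup.
have [y dy [cy1 cy2]] := wave_truncation Xx.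
have Xy n : X (y n) by have [] := dy n.
have [XS Slin [M SM]] := Sb t t0.
have SB n : S t (y n) - S t x = S t (y n - x).
  by have := Slin (-1) x (y n) Xx (Xy n); rewrite !scaleN1r ![- _ + _]addrC.
have Xd n : X (y n - x) by exact: energy_spaceB.
have cN : (fun n => N (y n - x)) @ \oo --> (0 : R).
  have c : (fun n => `|T (y n).1 - T x.1| + `|(y n).2 - x.2|) @ \oo --> (0 : R).
    rewrite -[X in _ --> X]addr0; apply: cvgD; apply/cvgr0Pnorm_lt => e e0.
      by have /cvgrPdistC_lt/(_ _ e0) := cy1; apply: filterS => n; rewrite normr_id.
    by have /cvgrPdistC_lt/(_ _ e0) := cy2; apply: filterS => n; rewrite normr_id.
  apply: (squeeze_cvgr _ (cvg_cst 0) c); apply: nearW => n.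
  rewrite energy_norm_ge0/= -op_sqrtB//; exact: energy_norm_le.
have cSN : (fun n => N (S t (y n) - S t x)) @ \oo --> (0 : R).
  have c : (fun n => M * N (y n - x)) @ \oo --> M * 0 by exact: cvgMr.
  rewrite mulr0 in c.
  apply: (squeeze_cvgr _ (cvg_cst 0) c); apply: nearW => n.
  by rewrite energy_norm_ge0/= SB; exact: SM.
have cvgS (F : H * H -> H) :
    (forall z z', X z -> X z' -> `|F z - F z'| <= N (z - z')) ->
    F (S t (y n)) @[n --> \oo] --> F (S t x).
  move=> FN; apply/cvgrPdistC_lt => e e0.
  have : \forall n \near \oo, `|N (S t (y n) - S t x)| < e.
    exact: (cvgr0_norm_lt _ cSN).
  apply: filterS => n; apply: le_lt_trans; apply: le_trans (ler_norm _).
  by apply: FN; exact: XS.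
have c1 : T (S t (y n)).1 @[n --> \oo] --> T (S t x).1.
  apply: (cvgS (fun z => T z.1)) => z z' Xz Xz'.
  by rewrite -op_sqrtB//; exact: op_sqrt_le_energy.
have c2 : (S t (y n)).2 @[n --> \oo] --> (S t x).2.
  by apply: (cvgS snd) => z z' _ _; exact: (snd_le_energy A E (z - z')).
have sq (u : nat -> H) l : u n @[n --> \oo] --> l -> `|u n| ^+ 2 @[n --> \oo] --> `|l| ^+ 2.
  move=> ul; rewrite expr2; under eq_fun do rewrite expr2.
  by apply: cvgM; exact: cvg_norm.
have d1 : N (S t (y n)) ^+ 2 @[n --> \oo] --> N (S t x) ^+ 2.
  rewrite sqr_energy_norm; under eq_fun do rewrite sqr_energy_norm.
  by apply: cvgD; exact: sq.
set K := 2 / q * _.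
have d2 : K ^+ 2 * N (y n) ^+ 2 @[n --> \oo] --> K ^+ 2 * N x ^+ 2.
  apply: cvgMr; rewrite sqr_energy_norm; under eq_fun do rewrite sqr_energy_norm.
  by apply: cvgD; exact: sq.
have K0 : 0 <= K.
  by have /andP[q0 _] := q01; rewrite mulr_ge0 ?expR_ge0// divr_ge0// ltW.
have KN0 : 0 <= K * N x by rewrite mulr_ge0// energy_norm_ge0.
rewrite -(@ler_pXn2r _ 2) ?nnegrE ?KN0 ?energy_norm_ge0// exprMn.
apply: (ler_cvg_to d1 d2); apply: nearW => n; exact: wave_decay_dom.
Qed.

Lemma operator_norm_decay q r t : 0 <= t -> 0 < q <= 1 -> rates q r ->
  operator_norm X N (S t) <= 2 / q * expR (- r * t).
Proof.
move=> t0 q01 rs; apply: ge_sup.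
  (* The supremum is bounded through its upper bounds only if the set is nonempty; the zero vector
     is a witness. *)
  exists (N (S t 0)), 0 => //; split; first exact: energy_space0.
  by rewrite energy_norm0.
move=> _ [x [Xx x1] <-]; apply: le_trans (wave_decay Xx t0 q01 rs) _.
have /andP[q0 _] := q01.
by rewrite ler_piMr// mulr_ge0 ?expR_ge0// divr_ge0// ltW.
Qed.

End UniformDecay.

(** * Admissible rates below the infimum of [phi] *)

Section DecayRate.
Context {R : realType} {H : hilbertType R} (A : operator H) (f : R -> R).
Hypothesis A_spectrum : forall s, spectrum A s -> 0 < s.
Hypothesis f_positive : forall s, spectrum A s -> 0 < f s.
Local Notation m := (m_star A f).

Lemma phi_ge0 s : spectrum A s -> 0 <= phi f s.
Proof.
move=> Ds; have fs := f_positive Ds; rewrite /phi; case: ifPn => _; first exact: ltW.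
rewrite subr_ge0 -[leRHS]ger0_norm ?(ltW fs)// -sqrtr_sqr ler_wsqrtr//.
by rewrite gerBl ltW// A_spectrum.
Qed.

Lemma m_star_le s : spectrum A s -> m <= phi f s.
Proof.
move=> Ds; apply: ge_inf; last by exists s.
by exists 0 => _ [u Du <-]; exact: phi_ge0.
Qed.

Lemma m_star_ge0 : 0 <= m.
Proof.
(* If the spectrum is empty, the infimum takes its default value 0. *)
rewrite /m_star; have [->|ne0] := eqVneq [set phi f s | s in spectrum A] set0.
  by rewrite inf0.
apply: lb_le_inf; first exact/set0P.
by move=> _ [u Du <-]; exact: phi_ge0.
Qed.

Lemma phi_le s : phi f s <= f s.
Proof. by rewrite /phi; case: ifPn => // _; rewrite gerBl sqrtr_ge0. Qed.

(** The two branches of [phi] are the rates of the small and large damping cases of [rate_okP], so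
    only the cutoff region leaves a condition. *)
Lemma rates_m_star q r : 0 < q <= 1 -> r <= m ->
  (forall s, spectrum A s -> Num.sqrt (1 - q ^+ 2) * Num.sqrt s < f s ->
    Num.sqrt (1 - q ^+ 2) * f s < Num.sqrt s -> r <= f s * (1 - q)) ->
  forall s, spectrum A s -> rate_ok (Num.sqrt s) (f s) q r.
Proof.
move=> q01 rm near_r s Ds; have s0 := A_spectrum Ds.
have mphi := m_star_le Ds.
apply: rate_okP => //; [by rewrite sqrtr_gt0|exact: f_positive|..].
- by move=> fs; move: mphi; rewrite /phi fs => /(le_trans rm).
- rewrite ltNge => /negbTE fs; rewrite sqr_sqrtr ?(ltW s0)//.
  by move: mphi; rewrite /phi fs => /(le_trans rm).
- exact: near_r.
Qed.

End DecayRate.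

(** * The two decay estimates *)

Theorem theorem4p2 (R : realType) (H : hilbertType R)
    (H_separable : separable_space H)
    (A : operator H)
    (A_selfadjoint : selfadjoint A)
    (A_positive : strictly_positive A)
    (A_spectrum : forall s, spectrum A s -> 0 < s)
    (E : spectral_measure H)
    (E_spectral : is_spectral_measure_of A E)
    (f : R -> R)
    (f_positive : forall s, spectrum A s -> 0 < f s)
    (f_continuous : {within spectrum A, continuous f})
    (f_inf : (0 < ereal_inf [set (f s)%:E | s in spectrum A])%E)
    (f_sup : (ereal_sup [set (f s / s)%:E | s in spectrum A] < +oo)%E)
    (S : R -> H * H -> H * H)
    (S_semigroup : C0_semigroup (energy_space A E) (energy_norm A E) S)
    (S_generator : is_generator (energy_space A E) (energy_norm A E)
                     (wave_operator A E f) S) :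
  exists C : R, 1 <= C /\
    (~ resonant A f ->
       forall t : R, 0 <= t ->
         operator_norm (energy_space A E) (energy_norm A E) (S t)
           <= C * expR (- m_star A f * t)) /\
    (resonant A f ->
       forall t : R, 0 <= t ->
         operator_norm (energy_space A E) (energy_norm A E) (S t)
           <= C * (1 + t) * expR (- m_star A f * t)).
Proof.
have f_le : exists c, forall s, spectrum A s -> f s <= c * s.
  set u := ereal_sup _ in f_sup.
  have ub s : spectrum A s -> ((f s / s)%:E <= u)%E.
    by move=> Ds; apply: ereal_sup_ubound; exists s.
  exists (fine u) => s Ds; rewrite -ler_pdivrMr ?A_spectrum//.
  have := ub s Ds; move: f_sup; case: u {ub} => //= c _.
have m0 := m_star_ge0 A_spectrum f_positive; set m := m_star A f in m0 *.
have decay := operator_norm_decay E_spectral A_spectrum f_positive f_continuous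
  f_le S_semigroup S_generator.
have [res|nres] := pselect (resonant A f).
- exists (2 * expR m); split; first by have := expR_ge1Dx m; lra.
  split=> // _ t t0.
  (* The cutoff depends on the time at which the norm is estimated, which is harmless since the
     decay bound holds for each [q] and [t] separately. *)
  pose q := (1 + t)^-1.
  have t1 : 0 < 1 + t by lra.
  have q0 : 0 < q by rewrite invr_gt0.
  have q1 : q <= 1 by rewrite invf_le1// lerDl.
  have q01 : 0 < q <= 1 by rewrite q0.
  have rates : forall s, spectrum A s -> rate_ok (Num.sqrt s) (f s) q (m * (1 - q)).
    apply: rates_m_star => // [|s Ds _ _].
      by rewrite ler_piMr// gerBl ltW.
    apply: ler_wpM2r; first by rewrite subr_ge0.
    exact: le_trans (m_star_le A_spectrum f_positive Ds) (phi_le f s).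
  apply: le_trans (decay _ _ _ t0 q01 rates) _.
  (* The excess exponent is [m q t], with [q t = t / (1 + t) <= 1]. *)
  have h : expR (- (m * (1 - q)) * t) <= expR m * expR (- m * t).
    have : q * t <= 1 by rewrite /q mulrC ler_pdivrMr// mul1r; lra.
    by rewrite -expRD ler_expR => /(ler_wpM2l m0); lra.
  have -> : 2 * expR m * (1 + t) * expR (- m * t) =
      2 * (1 + t) * (expR m * expR (- m * t)) by ring.
  have -> : 2 / q = 2 * (1 + t) by rewrite /q invrK.
  by rewrite ler_pM2l// mulr_gt0.
(* Where [f s = sqrt s] one has [phi f s = f s >= m], and equality would be a resonance. *)
- have gap s : spectrum A s -> f s = Num.sqrt s -> m < f s.
    move=> Ds fs; rewrite lt_neqAle; apply/andP; split.
      apply/eqP => mf; apply: nres; exists s; split=> //.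
      by rewrite /phi fs lexx -fs.
    exact: le_trans (m_star_le A_spectrum f_positive Ds) (phi_le f s).
  have [q q01 qP] := nonresonant_gap (closed_spectrum E_spectral) f_continuous
    m0 A_spectrum f_positive gap.
  have /andP[q0 q1] := q01.
  exists (2 / q); split; first by rewrite ler_pdivlMr//; lra.
  split=> // _ t t0; apply: decay => //.
  exact: rates_m_star.
Qed.
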